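(* Let $\mathcal{H}_A,\mathcal{H}_B$ have finite dimensions $d_A,d_B$ and $d=\min\{d_A,d_B\}$. For every state $\rho$ on $\mathcal{H}_A\otimes\mathcal{H}_B$, every integer $1\le h\le d^2$ and every $p\in[1,\infty)$, one has $\mathcal{D}^A_{h,p}(\rho)\ge0$. Moreover, for $h\in\{1,2\}$ and every $p\in[1,\infty)$, $\mathcal{D}^A_{h,p}(\rho)=0$ if and only if $\mathcal{D}^A_G(\rho)=0$.
   Context: Let $\{A_i\}$, $\{B_j\}$ be orthonormal bases (w.r.t. the Hilbert–Schmidt inner product $\mathrm{tr}(XY)$) of the real spaces of Hermitian operators on $\mathcal{H}_A$, $\mathcal{H}_B$, and for a state $\sigma$ let $\mathcal{C}(\sigma)_{ij}=\mathrm{tr}(\sigma\,A_i\otimes B_j)$, with singular values $\sigma_1\ge\cdots\ge\sigma_{d^2}$. The Correlation Minor Norm is $\mathcal{M}_{h,p}(\sigma)=\big(\sum_{R\subseteq\{1,\ldots,d^2\},|R|=h}\prod_{k\in R}\sigma_k^p\big)^{1/p}$. A projective measurement $\Pi^A$ on $A$ is given by an orthonormal basis $\{|l\rangle\}_{l=1}^{d_A}$ of $\mathcal{H}_A$, with $\Pi_l=|l\rangle\langle l|$, and acts by $\Pi^A[\rho]=\sum_{l=1}^{d_A}(\Pi_l\otimes\mathbb{1})\rho(\Pi_l\otimes\mathbb{1})$. Define $$\mathcal{D}^A_{h,p}(\rho)=[\mathcal{M}_{h,p}(\rho)]^p-\max_{\Pi^A}[\mathcal{M}_{h,p}(\Pi^A[\rho])]^p,$$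 the maximum over all such projective measurements on $A$. The geometric quantum discord is $\mathcal{D}^A_G(\rho)=\min_{\chi}\|\rho-\chi\|^2$, where $\|\cdot\|$ is the Hilbert–Schmidt (Frobenius) norm and the minimum is over classical-quantum states $\chi=\sum_k p_k|k\rangle\langle k|\otimes\chi_k$, with $\{|k\rangle\}$ an orthonormal basis of $\mathcal{H}_A$, $(p_k)$ a probability vector and $\chi_k$ states on $\mathcal{H}_B$. *)

(* Defs.v *)
(* R : realType, complex numbers R[i] (mathcomp-real-closed). *)
From HB Require Import structures.
From mathcomp Require Import all_boot all_order all_algebra.
From mathcomp Require Import spectral.
From mathcomp Require Import complex mxtens.
From mathcomp Require Import boolp classical_sets reals exp.

Set Implicit Arguments.
Unset Strict Implicit.
Unset Printing Implicit Defensive.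

Import Order.TTheory GRing.Theory Num.Theory.
Local Open Scope ring_scope.
Local Open Scope sesquilinear_scope.

Section QDiscord.
Variable R : realType.
Local Notation C := (R[i]).

(* Hermitian (self-adjoint) matrices *)
Definition hermitian n (X : 'M[C]_n) : Prop := X ^t* = X.

(* density matrices (states): Hermitian, positive semidefinite, trace one *)
Definition is_state n (rho : 'M[C]_n) : Prop :=
  [/\ hermitian rho,
      (forall v : 'cV[C]_n, 0 <= ((v ^t*) *m rho *m v) 0 0)
    & \tr rho = 1].

(* Hilbert-Schmidt inner product tr(XY), real on Hermitian operators *)
Definition hs_inner n (X Y : 'M[C]_n) : C := \tr (X *m Y).

(* {F_i}_{i < n^2} is an orthonormal basis (w.r.t. tr(XY)) of the real vector
   space of Hermitian operators on C^n *)
Definition herm_onb n (F : 'I_(n ^ 2) -> 'M[C]_n) : Prop :=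
  [/\ forall i, hermitian (F i),
      forall i j, hs_inner (F i) (F j) = (i == j)%:R
    & forall X : 'M[C]_n, hermitian X ->
        exists c : 'I_(n ^ 2) -> R, X = \sum_i ((c i)%:C)%C *: F i].

(* correlation matrix C(sigma)_{ij} = tr(sigma (A_i (x) B_j)) (a real number) *)
Definition corr_mx dA dB (FA : 'I_(dA ^ 2) -> 'M[C]_dA)
  (FB : 'I_(dB ^ 2) -> 'M[C]_dB) (sigma : 'M[C]_(dA * dB)) :
  'M[R]_(dA ^ 2, dB ^ 2) :=
  \matrix_(i, j) complex.Re (\tr (sigma *m (FA i *t FB j))).

(* orthogonal real matrices *)
Definition orthogonal_mx n (U : 'M[R]_n) : Prop := U *m U^T = 1%:M.

(* s is the nonincreasing list of the singular values of M, i.e.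
   M = U * diag(s) * V^T with U, V orthogonal *)
Definition svd_spec m n (M : 'M[R]_(m, n)) (s : seq R) : Prop :=
  [/\ size s = minn m n,
      forall k, 0 <= nth 0 s k,
      sorted (fun x y => y <= x) s
    & exists (U : 'M[R]_m) (V : 'M[R]_n),
        [/\ orthogonal_mx U, orthogonal_mx V &
            M = U *m (\matrix_(i, j) if (i : nat) == j then nth 0 s i else 0)
                  *m V^T]].

(* the singular values sigma_1 >= sigma_2 >= ... (uniquely determined) *)
Definition svals m n (M : 'M[R]_(m, n)) : seq R :=
  match pselect (exists s, svd_spec M s) with
  | left H => projT1 (cid H)
  | right _ => [::]
  end.

(* Correlation Minor Norm M_{h,p}(sigma) *)
Definition cmn dA dB (FA : 'I_(dA ^ 2) -> 'M[C]_dA)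
  (FB : 'I_(dB ^ 2) -> 'M[C]_dB) (h : nat) (p : R)
  (sigma : 'M[C]_(dA * dB)) : R :=
  let s := svals (corr_mx FA FB sigma) in
  (\sum_(S : {set 'I_(minn dA dB ^ 2)} | #|S| == h)
      \prod_(k in S) (nth 0 s k) `^ p) `^ p^-1.

(* projective measurement on A given by the orthonormal basis formed by the
   columns of the unitary U : Pi^A[rho] = sum_l (Pi_l (x) 1) rho (Pi_l (x) 1) *)
Definition proj_meas dA dB (U : 'M[C]_dA) (rho : 'M[C]_(dA * dB)) :
  'M[C]_(dA * dB) :=
  \sum_(l < dA)
    ((col l U *m (col l U) ^t*) *t (1%:M : 'M[C]_dB)) *m rho
      *m ((col l U *m (col l U) ^t*) *t (1%:M : 'M[C]_dB)).

(* D^A_{h,p}(rho) = M_{h,p}(rho)^p - max_{Pi^A} M_{h,p}(Pi^A[rho])^p *)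
Definition discordA dA dB (FA : 'I_(dA ^ 2) -> 'M[C]_dA)
  (FB : 'I_(dB ^ 2) -> 'M[C]_dB) (h : nat) (p : R)
  (rho : 'M[C]_(dA * dB)) : R :=
  cmn FA FB h p rho `^ p -
  sup [set x | exists U : 'M[C]_dA,
                 U \is unitarymx /\ x = cmn FA FB h p (@proj_meas dA dB U rho) `^ p].

(* squared Hilbert-Schmidt (Frobenius) norm *)
Definition hs_norm2 m n (X : 'M[C]_(m, n)) : R :=
  \sum_i \sum_j ((complex.Re (X i j)) ^+ 2 + (complex.Im (X i j)) ^+ 2).

(* classical-quantum states sum_k p_k |k><k| (x) chi_k *)
Definition cq_state dA dB (chi : 'M[C]_(dA * dB)) : Prop :=
  exists (U : 'M[C]_dA) (pr : 'I_dA -> R) (chik : 'I_dA -> 'M[C]_dB),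
    [/\ U \is unitarymx,
        (forall k, 0 <= pr k), \sum_k pr k = 1,
        (forall k, is_state (chik k)) &
        chi = \sum_k ((pr k)%:C)%C *: ((col k U *m (col k U) ^t*) *t chik k)].

(* geometric discord D^A_G(rho) = min_chi ||rho - chi||^2 *)
Definition geom_discordA dA dB (rho : 'M[C]_(dA * dB)) : R :=
  inf [set x | exists chi : 'M[C]_(dA * dB),
                 @cq_state dA dB chi /\ x = hs_norm2 (rho - chi)].

End QDiscord.

(* Main.v *)
Require Import Defs.
From HB Require Import structures.
From mathcomp Require Import all_boot all_order all_algebra.
From mathcomp Require Import spectral.
From mathcomp Require Import complex mxtens.
From mathcomp Require Import boolp classical_sets reals exp.
From mathcomp Require Import topology normedtype derive.
From mathcomp Require Import ring lra.

(* A measurement Pi_U on A multiplies the correlation matrix C of rho by a real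
   orthogonal projection P, so by the min-max principle no singular value grows;
   this gives nonnegativity.  More precisely, with s, s' the singular values of
   C and P C and d = ||C - P C||^2 = ||rho - Pi_U rho||^2,
     s'_k <= s_k,   s_k^2 <= s'_k^2 + d,   d = sum_k (s_k^2 - s'_k^2).
   As the geometric discord is an infimum and the maximum a supremum, no
   compactness of the unitary group is needed.  If rho is close to a
   classical-quantum chi, a measurement fixing chi makes d small, hence the s'_k
   and the minor norm are nearly those of rho.  Conversely, if s_2 > 0, a nearly
   optimal measurement has all s'_k close to s_k when h is 1 or 2, so d is small
   while Pi_U rho is classical-quantum; if s_2 = 0, then rho = X (x) Y and
   measuring in an eigenbasis of X fixes rho. *)

Set Implicit Arguments.
Unset Strict Implicit.
Unset Printing Implicit Defensive.

Import Order.TTheory GRing.Theory Num.Theory.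
Import numFieldNormedType.Exports.
Local Open Scope ring_scope.
Local Open Scope sesquilinear_scope.

(* [hermitian] alone denotes the sesquilinear form structure. *)
Local Notation hermitian := Defs.hermitian.

(** * Frobenius norm and Householder reflections *)

Section Frobenius.
Variable R : realType.

Definition frob2 {m n} (M : 'M[R]_(m, n)) : R := \tr (M^T *m M).

Lemma frob2E m n (M : 'M[R]_(m, n)) : frob2 M = \sum_i \sum_j M i j ^+ 2.
Proof.
rewrite /frob2 /mxtrace exchange_big /=; apply: eq_bigr => j _.
by rewrite mxE; apply: eq_bigr => i _; rewrite mxE -expr2.
Qed.

Lemma frob2_ge0 m n (M : 'M[R]_(m, n)) : 0 <= frob2 M.
Proof. by rewrite frob2E; do 2!apply: sumr_ge0 => ? _; rewrite sqr_ge0. Qed.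

Lemma frob2_eq0 m n (M : 'M[R]_(m, n)) : frob2 M = 0 -> M = 0.
Proof.
rewrite frob2E => /eqP; rewrite psumr_eq0; last first.
  by move=> i _; apply: sumr_ge0 => j _; rewrite sqr_ge0.
move=> /allP M0; apply/matrixP => i j; rewrite mxE.
have := M0 i; rewrite mem_index_enum /= => /(_ isT).
rewrite psumr_eq0; last by move=> k _; rewrite sqr_ge0.
by move=> /allP/(_ j); rewrite mem_index_enum sqrf_eq0 => /(_ isT)/eqP.
Qed.

Lemma frob20 m n : frob2 (0 : 'M[R]_(m, n)) = 0.
Proof. by rewrite /frob2 mulmx0 mxtrace0. Qed.

Lemma trmx_scale m n a (M : 'M[R]_(m, n)) : (a *: M)^T = a *: M^T.
Proof. by rewrite linearZ. Qed.

Lemma frob2Z m n a (M : 'M[R]_(m, n)) : frob2 (a *: M) = a ^+ 2 * frob2 M.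
Proof.
by rewrite /frob2 trmx_scale -scalemxAl -scalemxAr scalerA mxtraceZ.
Qed.

Lemma frob2T m n (M : 'M[R]_(m, n)) : frob2 M^T = frob2 M.
Proof. by rewrite /frob2 trmxK mxtrace_mulC. Qed.

Lemma frob2_cVE n (v : 'cV[R]_n) : frob2 v = (v^T *m v) 0 0.
Proof. by rewrite /frob2 trace_mx11. Qed.

Lemma frob2_col_mx m1 m2 n (A : 'M[R]_(m1, n)) (B : 'M[R]_(m2, n)) :
  frob2 (col_mx A B) = frob2 A + frob2 B.
Proof. by rewrite /frob2 tr_col_mx mul_row_col mxtraceD. Qed.

Lemma orthogonal_mxC {n} {U : 'M[R]_n} : orthogonal_mx U -> U^T *m U = 1%:M.
Proof. exact: mulmx1C. Qed.

Lemma frob2_orthl m n (U : 'M[R]_m) (M : 'M[R]_(m, n)) :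
  orthogonal_mx U -> frob2 (U *m M) = frob2 M.
Proof.
by move=> /orthogonal_mxC oU; rewrite /frob2 trmx_mul mulmxA -(mulmxA M^T) oU mulmx1.
Qed.

Lemma frob2_orthr m n (V : 'M[R]_n) (M : 'M[R]_(m, n)) :
  orthogonal_mx V -> frob2 (M *m V^T) = frob2 M.
Proof.
by move=> oV; rewrite -frob2T trmx_mul trmxK frob2_orthl ?frob2T.
Qed.

(** By Lagrange's identity, the right side minus the left is half the double sum of the squares of
    a_i b_j - a_j b_i. *)
Lemma cauchy_schwarz_sum n (a b : 'I_n -> R) :
  (\sum_i a i * b i) ^+ 2 <= (\sum_i a i ^+ 2) * (\sum_i b i ^+ 2).
Proof.
have : 0 <= \sum_i \sum_j (a i * b j - a j * b i) ^+ 2.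
  by do 2!apply: sumr_ge0 => ? _; rewrite sqr_ge0.
suff -> : \sum_i \sum_j (a i * b j - a j * b i) ^+ 2 =
  2%:R * ((\sum_i a i ^+ 2) * (\sum_i b i ^+ 2) - (\sum_i a i * b i) ^+ 2).
  by rewrite pmulr_rge0 // subr_ge0.
have -> : \sum_i \sum_j (a i * b j - a j * b i) ^+ 2 =
  \sum_i \sum_j (a i ^+ 2 * b j ^+ 2) + \sum_i \sum_j (b i ^+ 2 * a j ^+ 2) -
   2%:R * \sum_i \sum_j ((a i * b i) * (a j * b j)).
  rewrite mulr_sumr -big_split -sumrB /=; apply: eq_bigr => i _.
  rewrite mulr_sumr -big_split -sumrB /=; apply: eq_bigr => j _; ring.
have E (f g : 'I_n -> R) : \sum_i \sum_j (f i * g j) = (\sum_i f i) * (\sum_i g i).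
  by rewrite mulr_suml; apply: eq_bigr => i _; rewrite mulr_sumr.
rewrite !E; ring.
Qed.

(** Cauchy-Schwarz on each entry. For a column [B] it says that the Frobenius norm dominates the
    operator norm. *)
Lemma frob2_mulmx_le m n p (A : 'M[R]_(m, n)) (B : 'M[R]_(n, p)) :
  frob2 (A *m B) <= frob2 A * frob2 B.
Proof.
rewrite -(frob2T B) !frob2E mulr_suml; apply: ler_sum => i _.
rewrite mulr_sumr; apply: ler_sum => j _.
rewrite mxE; apply: le_trans (cauchy_schwarz_sum _ _) _.
rewrite le_eqVlt; apply/orP; left; apply/eqP; congr (_ * _).
by apply: eq_bigr => k _; rewrite mxE.
Qed.

Lemma frob2_dot_le n (u v : 'cV[R]_n) : (u^T *m v) 0 0 ^+ 2 <= frob2 u * frob2 v.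
Proof.
have := frob2_mulmx_le u^T v; rewrite frob2T; apply: le_trans.
by rewrite frob2E big_ord1 big_ord1.
Qed.

(** Reflection in the hyperplane orthogonal to w = u - e_0 swaps the unit vectors u and e_0. The
    identity serves when w = 0. *)
Lemma householder n (u : 'cV[R]_n.+1) : frob2 u = 1 ->
  exists H : 'M[R]_n.+1, [/\ H^T = H, H *m H = 1%:M & H *m delta_mx 0 0 = u].
Proof.
move=> u1; set e : 'cV[R]_n.+1 := delta_mx 0 0.
have [->|ue] := eqVneq u e.
  by exists 1%:M; rewrite trmx1 mulmx1 mul1mx.
pose w := u - e; pose c := 2%:R / frob2 w.
have e1 : (e^T *m e) = 1%:M.
  apply/matrixP => i j; rewrite !ord1 mxE (bigD1 0) //= !mxE /= mulr1.
  by rewrite big1 ?addr0 // => k /negbTE k0; rewrite !mxE k0 mul0r.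
have uu : u^T *m u = 1%:M by rewrite [LHS]mx11_scalar -frob2_cVE u1.
have w0 : frob2 w != 0.
  by apply: contra ue => /eqP /frob2_eq0 /eqP; rewrite subr_eq0.
have ww : w^T *m w = (frob2 w)%:M by rewrite [LHS]mx11_scalar -frob2_cVE.
(* For unit u and e, both |w|^2 = 2 - 2 <u, e> and <w, e> = <u, e> - 1. *)
have we : w^T *m e = (- (frob2 w / 2%:R))%:M.
  have ue_eu : u^T *m e = e^T *m u.
    rewrite -[LHS]trmxK trmx_mul trmxK [X in X^T]mx11_scalar tr_scalar_mx.
    by rewrite -mx11_scalar.
  rewrite frob2_cVE [LHS]mx11_scalar; congr (_%:M).
  rewrite /w !linearB /= !mulmxBl uu e1 ue_eu !mxE /=; by field.
exists (1%:M - c *: (w *m w^T)); split.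
- by rewrite linearB /= linearZ /= trmx_mul trmxK trmx1.
- rewrite mulmxBl mul1mx mulmxBr mulmx1 -scalemxAl -scalemxAr.
  rewrite mulmxA -(mulmxA w) ww mul_mx_scalar -scalemxAl !scalerA.
  have -> : c * (c * frob2 w) = c + c by rewrite /c; field; rewrite ?w0.
  by rewrite scalerDl opprB addrK subrK.
- rewrite mulmxBl mul1mx -scalemxAl -mulmxA we mul_mx_scalar scalerA.
  have -> : c * - (frob2 w / 2%:R) = -1 by rewrite /c; field; rewrite ?w0.
  by rewrite scaleN1r opprK /w addrC subrK.
Qed.

End Frobenius.

(** * Singular value decomposition *)

Section SVD.
Variable R : realType.

Lemma continuous_frob2_mulmx m n (M : 'M[R]_(n, m)) :
  continuous (fun v : 'rV[R]_n => frob2 (v *m M)).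
Proof.
have sum_cont (T : topologicalType) k (f : 'I_k -> T -> R) :
    (forall i, continuous (f i)) -> continuous (fun x => \sum_i f i x).
  move=> fc x; elim: k f fc => [|k IH] f fc.
    by under eq_fun do rewrite big_ord0; exact: cst_continuous.
  under eq_fun do rewrite big_ord_recl.
  by apply: cvgD; [exact: fc | apply: IH => i; exact: fc].
under eq_fun do rewrite frob2E.
apply: (sum_cont) => i; apply: (sum_cont) => j; move=> x.
have H : continuous (fun v : 'rV[R]_n => (v *m M) i j).
  under eq_fun do rewrite mxE.
  apply: (sum_cont) => k y; apply: (@continuousM R 'rV[R]_n (fun v => v i k) (fun=> M k j)).
    exact: coord_continuous.
  exact: cst_continuous.
by apply: (@continuousM R 'rV[R]_n (fun v => (v *m M) i j)); exact: H.
Qed.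

Lemma compact_unit_sphere n : compact [set v : 'rV[R]_n | frob2 v = 1].
Proof.
apply: bounded_closed_compact.
  exists 1; split; first exact: num_real.
  move=> M M1 v /= v1; apply: le_trans (ltW M1).
  rewrite -[`|v|]/(mx_norm v) mx_normrE; apply/bigmax_leP; split => //= -[i j] _ /=.
  rewrite -(@ler_pXn2r _ 2) ?nnegrE // expr1n real_normK ?num_real //.
  rewrite -v1 frob2E (bigD1 i) //= (bigD1 j) //= -addrA lerDl.
  by apply: addr_ge0; rewrite ?sumr_ge0 // => *; rewrite ?sumr_ge0 // => *; rewrite sqr_ge0.
have -> : ([set v : 'rV[R]_n | frob2 v = 1%R] =
    (fun v => frob2 (v *m 1%:M)%R) @^-1` [set 1%R])%classic.
  by apply/seteqP; split => v /=; rewrite mulmx1.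
apply: preimage_closed; first by move=> v _; exact: continuous_frob2_mulmx.
exact: closed_eq.
Qed.

Lemma frob2_delta n (i : 'I_n) : frob2 (delta_mx i 0 : 'cV[R]_n) = 1.
Proof.
rewrite frob2E (bigD1 i) //= big_ord1 mxE !eqxx expr1n big1 ?addr0 // => j.
by move=> /negbTE ji; rewrite big_ord1 mxE ji expr0n.
Qed.

(** The extreme value theorem on the compact unit sphere, extended to all w by homogeneity. *)
Lemma max_stretch m n (M : 'M[R]_(m, n.+1)) : exists v : 'cV[R]_n.+1,
  frob2 v = 1 /\ forall w : 'cV[R]_n.+1, frob2 (M *m w) <= frob2 (M *m v) * frob2 w.
Proof.
have S0 : ([set v : 'rV[R]_n.+1 | frob2 v = 1%R] !=set0)%classic.
  by exists (delta_mx 0 0) => /=; rewrite -frob2T trmx_delta frob2_delta.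
have [] := EVT_max_rV S0 (@compact_unit_sphere n.+1)
  (continuous_subspaceT (@continuous_frob2_mulmx _ _ M^T)).
move=> v; rewrite inE /= => v1 vmax; exists v^T; rewrite frob2T; split => // w.
have E (x : 'rV[R]_n.+1) : frob2 (M *m x^T) = frob2 (x *m M^T).
  by rewrite -frob2T trmx_mul trmxK.
have [/eqP /frob2_eq0 ->|w0] := boolP (frob2 w == 0).
  by rewrite mulmx0 !frob20 mulr0.
have w_gt0 : 0 < frob2 w by rewrite lt_def w0 frob2_ge0.
have := vmax ((Num.sqrt (frob2 w))^-1 *: w^T).
rewrite inE /= frob2Z exprVn sqr_sqrtr ?frob2_ge0 // frob2T mulVf // => /(_ erefl).
rewrite -scalemxAl frob2Z exprVn sqr_sqrtr ?frob2_ge0 // -!E trmxK.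
by rewrite mulrC ler_pdivrMr.
Qed.

(** Take a unit v of maximal stretch, s = |M v| and u = M v / s. Then <v, M^T u> = s, and |M^T u| <=
    s by maximality, so |M^T u - s v|^2 = |M^T u|^2 - s^2 <= 0. *)
Lemma top_singular m n (M : 'M[R]_(m.+1, n.+1)) :
  exists (u : 'cV[R]_m.+1) (v : 'cV[R]_n.+1) (s : R),
  [/\ frob2 u = 1, frob2 v = 1, 0 <= s,
    M *m v = s *: u /\ M^T *m u = s *: v
   & forall w : 'cV[R]_n.+1, frob2 (M *m w) <= s ^+ 2 * frob2 w].
Proof.
have [v [v1 vmax]] := max_stretch M.
have [/eqP Mv0|Mv0] := boolP (frob2 (M *m v) == 0).
  have M0 : M = 0.
    apply/matrixP => i j; have := vmax (delta_mx j 0).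
    rewrite Mv0 mul0r => h; have /eqP : frob2 (M *m delta_mx j (0 : 'I_1)) = 0.
      by apply/le_anti; rewrite h frob2_ge0.
    by move=> /eqP /frob2_eq0; rewrite -colE => /matrixP /(_ i 0); rewrite !mxE.
  exists (delta_mx 0 0), v, 0; rewrite frob2_delta M0 trmx0 !mul0mx !scale0r.
  by split => // w; rewrite mul0mx frob20 mulr_ge0 ?frob2_ge0 ?sqr_ge0.
set s2 := frob2 (M *m v) in vmax Mv0.
have s2_gt0 : 0 < s2 by rewrite lt_def Mv0 frob2_ge0.
pose s := Num.sqrt s2.
have ss : s ^+ 2 = s2 by rewrite sqr_sqrtr ?ltW.
have s_gt0 : 0 < s by rewrite sqrtr_gt0.
have s0 : s != 0 by rewrite gt_eqF.
pose u := s^-1 *: (M *m v).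
have u1 : frob2 u = 1 by rewrite frob2Z exprVn ss mulVf.
have Mv : M *m v = s *: u by rewrite scalerA divff // scale1r.
(* With t = |M^T u|^2 = <u, M M^T u>, Cauchy-Schwarz and maximality give t^2 <= |M (M^T u)|^2 <= s^2
   t. *)
have bT : frob2 (M^T *m u) <= s ^+ 2.
  set t := frob2 (M^T *m u).
  have h : t ^+ 2 <= s2 * t.
    have -> : t = (u^T *m (M *m (M^T *m u))) 0 0.
      by rewrite /t frob2_cVE trmx_mul trmxK !mulmxA.
    apply: le_trans (frob2_dot_le _ _) _; rewrite u1 mul1r.
    by apply: le_trans (vmax _) _; rewrite frob2_cVE trmx_mul trmxK !mulmxA.
  rewrite ss; have [->|t0] := eqVneq t 0; first exact: ltW.
  have t_gt0 : 0 < t by rewrite lt_def t0 frob2_ge0.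
  by rewrite -(ler_pM2r t_gt0) -expr2.
exists u, v, s; split => //; first exact: ltW; last by move=> w; rewrite ss.
split => //; apply/eqP; rewrite -subr_eq0; apply/eqP/frob2_eq0.
apply/le_anti; rewrite frob2_ge0 andbT.
set a := M^T *m u in bT *.
have va : v^T *m a = s%:M.
  rewrite [LHS]mx11_scalar mulmxA -trmx_mul Mv trmx_scale -scalemxAl mxE.
  by rewrite -frob2_cVE u1 mulr1.
have av : a^T *m v = s%:M by rewrite -[s%:M]tr_scalar_mx -va [RHS]trmx_mul trmxK.
have aa : a^T *m a = (frob2 a)%:M by rewrite [LHS]mx11_scalar -frob2_cVE.
have vv : v^T *m v = 1%:M by rewrite [LHS]mx11_scalar -frob2_cVE v1.
have tB : (a - s *: v)^T = a^T - s *: v^T by rewrite linearB /= trmx_scale.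
rewrite frob2_cVE tB mulmxBl !mulmxBr -!scalemxAl -!scalemxAr !scalerA.
rewrite va av aa vv !mxE /= !mulr1n -!expr2 mulr1 subrr subr0 subr_le0; exact: bT.
Qed.

End SVD.

(** * Existence and comparison of singular values *)

Section SingularValues.
Variable R : realType.

Definition diag_rect m n (s : seq R) : 'M[R]_(m, n) :=
  \matrix_(i, j) if (i : nat) == j then nth 0 s i else 0.

Lemma diag_rect_cons m n a (s : seq R) :
  diag_rect (1 + m) (1 + n) (a :: s) = block_mx a%:M 0 0 (diag_rect m n s).
Proof.
apply/matrixP => i j; rewrite mxE.
case: (splitP i) => i' ei; case: (splitP j) => j' ej.
- have -> : i = lshift m i' by apply/val_inj.
  have -> : j = lshift n j' by apply/val_inj.
  by rewrite block_mxEul !ord1 mxE.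
- have -> : i = lshift m i' by apply/val_inj.
  have -> : j = rshift 1 j' by apply/val_inj.
  by rewrite block_mxEur !ord1 mxE.
- have -> : i = rshift 1 i' by apply/val_inj.
  have -> : j = lshift n j' by apply/val_inj.
  by rewrite block_mxEdl !ord1 mxE.
- have -> : i = rshift 1 i' by apply/val_inj.
  have -> : j = rshift 1 j' by apply/val_inj.
  by rewrite block_mxEdr mxE /= !add1n eqSS.
Qed.

Lemma diag_rect_gram m n (s : seq R) : (size s <= m)%N ->
  (diag_rect m n s)^T *m diag_rect m n s = diag_mx (\row_(j < n) nth 0 s j ^+ 2).
Proof.
move=> sm; apply/matrixP => j l; rewrite !mxE.
have [jm|mj] := ltnP j m; last first.
  (* A column of index at least m is zero; the default value of [nth] agrees because
     [size s <= m]. *)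
  rewrite nth_default ?(leq_trans sm) // expr0n mul0rn big1 // => i _.
  by rewrite !mxE; case: eqP => [ij|_]; rewrite ?mul0r //; move: mj; rewrite -ij leqNgt ltn_ord.
rewrite (bigD1 (Ordinal jm)) //= !mxE /= eqxx big1 ?addr0; last first.
  by move=> i; rewrite -val_eqE /= => /negbTE ij; rewrite !mxE ij mul0r.
by rewrite -val_eqE; case: eqP; rewrite ?mulr0 ?mulr1n ?expr2.
Qed.

Lemma orthogonal_block n (U : 'M[R]_n) : orthogonal_mx U ->
  orthogonal_mx (block_mx (1%:M : 'M_1) 0 0 U).
Proof.
move=> oU; rewrite /orthogonal_mx tr_block_mx !trmx0 trmx1 mulmx_block.
by rewrite !(mulmx0, mul0mx, mulmx1, addr0, add0r) oU -scalar_mx_block.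
Qed.

Lemma orthogonal_mul n (U V : 'M[R]_n) :
  orthogonal_mx U -> orthogonal_mx V -> orthogonal_mx (U *m V).
Proof.
move=> oU oV; rewrite /orthogonal_mx trmx_mul mulmxA -(mulmxA U) oV mulmx1.
exact: oU.
Qed.

(** Deflation: two reflections bring the top singular pair to the first coordinate vectors, which
    leaves a block diagonal matrix. The bound [c] on the operator norm passes through the induction
    so that the list comes out sorted. *)
Lemma svd_exists_le m n (M : 'M[R]_(m, n)) (c : R) : 0 <= c ->
  (forall w : 'cV[R]_n, frob2 (M *m w) <= c ^+ 2 * frob2 w) ->
  exists s, svd_spec M s /\ nth 0 s 0 <= c.
Proof.
have triv m' n' (N : 'M[R]_(m', n')) : minn m' n' = 0%N -> N = 0 -> svd_spec N [::].
  move=> mn0 ->; split => //; first by case.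
  exists 1%:M, 1%:M; split; rewrite ?/orthogonal_mx trmx1 mulmx1 ?mul1mx //.
  by apply/matrixP => i j; rewrite !mxE nth_nil if_same.
elim: m n M c => [|m IH] [|n] M c c0 Mc.
- by exists [::]; split => //; apply: triv => //; rewrite [M]flatmx0.
- by exists [::]; split => //; apply: triv => //; rewrite ?min0n // [M]flatmx0.
- by exists [::]; split => //; apply: triv => //; rewrite ?minn0 // [M]thinmx0.
have [u [v [s [u1 v1 s0 [Mv Mu] smax]]]] := top_singular M.
have [H1 [H1T H1H H1e]] := householder u1.
have [H2 [H2T H2H H2e]] := householder v1.
have H1u : H1 *m u = delta_mx 0 0 by rewrite -H1e mulmxA H1H mul1mx.
have H2v : H2 *m v = delta_mx 0 0 by rewrite -H2e mulmxA H2H mul1mx.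
have o1 : orthogonal_mx H1 by rewrite /orthogonal_mx H1T.
have o2 : orthogonal_mx H2 by rewrite /orthogonal_mx H2T.
(* The dimensions are written as sums to allow block decomposition, and [N] is kept abstract. *)
have [N ND] : exists N : 'M[R]_(1 + m, 1 + n), N = H1 *m M *m H2 by eexists.
have Ne : N *m delta_mx 0 0 = s *: delta_mx 0 0 :> 'cV[R]_(1 + m).
  by rewrite ND -!mulmxA H2e Mv -scalemxAr H1u.
have NTe : N^T *m delta_mx 0 0 = s *: delta_mx 0 0 :> 'cV[R]_(1 + n).
  by rewrite ND !trmx_mul H1T H2T -!mulmxA H1e Mu -scalemxAr H2v.
pose N' := drsubmx N.
have NE : N = block_mx s%:M 0 0 N'.
  rewrite -[LHS]submxK; congr block_mx; apply/matrixP => i j.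
  - move/matrixP: Ne => /(_ 0 0); rewrite -colE !mxE !ord1 /= mulr1 => <-.
    by congr (N _ _); apply/val_inj.
  - move/matrixP: NTe => /(_ (rshift 1 j) 0); rewrite -colE !mxE !ord1 /= mulr0 => <-.
    by congr (N _ _); apply/val_inj.
  - move/matrixP: Ne => /(_ (rshift 1 i) 0); rewrite -colE !mxE !ord1 /= mulr0 => <-.
    by congr (N _ _); apply/val_inj.
(* [N] sends w padded with a leading 0 to the likewise padded [N' *m w], so the block inherits the
   bound [s] of [M]. *)
have N'max (w : 'cV[R]_n) : frob2 (N' *m w) <= s ^+ 2 * frob2 w.
  have F k (x : 'cV[R]_k) : frob2 (col_mx (0 : 'M[R]_1) x) = frob2 x.
    by rewrite frob2_col_mx frob20 add0r.
  have E : N *m col_mx (0 : 'M_1) w = col_mx 0 (N' *m w).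
    by rewrite NE mul_block_col !mul0mx mulmx0 !(add0r, addr0).
  have := smax (H2 *m (col_mx (0 : 'M_1) w)); rewrite frob2_orthl //.
  rewrite -(frob2_orthl (M *m _) o1) !mulmxA -ND E.
  by rewrite (F _ w) (F _ (N' *m w)).
have [s' [[ss' s'0 s's [U [V [oU oV N'E]]]] s'le]] := IH _ N' s s0 N'max.
exists (s :: s'); split; last first.
  rewrite /=; have := Mc v; rewrite Mv frob2Z u1 v1 !mulr1.
  by rewrite ler_pXn2r ?nnegrE.
split.
- by rewrite /= ss' minnSS.
- by case.
- by case: (s') s's s'le {ss' s'0 N'E} => //= a l -> ->.
pose BU := block_mx (1%:M : 'M[R]_1) 0 0 U; pose BV := block_mx (1%:M : 'M[R]_1) 0 0 V.
have NF : N = BU *m diag_rect (1 + m) (1 + n) (s :: s') *m BV^T.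
  rewrite diag_rect_cons /BU /BV tr_block_mx trmx1 !trmx0 !mulmx_block.
  by rewrite !(mulmx0, mul0mx, mulmx1, mul1mx, addr0, add0r) [LHS]NE N'E.
have MF : M = H1 *m N *m H2.
  by rewrite ND !mulmxA H1H mul1mx -mulmxA H2H mulmx1.
exists (H1 *m BU), (H2 *m BV); split.
- by apply: orthogonal_mul => //; exact: orthogonal_block.
- by apply: orthogonal_mul => //; exact: orthogonal_block.
by rewrite {1}MF NF trmx_mul H2T !mulmxA.
Qed.

Lemma svd_exists m n (M : 'M[R]_(m, n)) : exists s, svd_spec M s.
Proof.
have [w|s [? _]] := @svd_exists_le _ _ M (Num.sqrt (frob2 M)) (sqrtr_ge0 _).
  by rewrite sqr_sqrtr ?frob2_ge0 // frob2_mulmx_le.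
by exists s.
Qed.

Lemma svalsP m n (M : 'M[R]_(m, n)) : svd_spec M (svals M).
Proof.
by rewrite /svals; case: pselect => [H|[]]; [exact: projT2 (cid H) | exact: svd_exists].
Qed.

Lemma svals_ge0 m n (M : 'M[R]_(m, n)) k : 0 <= nth 0 (svals M) k.
Proof. by have [] := svalsP M. Qed.

Lemma svals_nth_le m n (M : 'M[R]_(m, n)) i j : (i <= j)%N ->
  nth 0 (svals M) j <= nth 0 (svals M) i.
Proof.
have [_ s0 ss _] := svalsP M => ij; have [jl|lj] := ltnP j (size (svals M)); last first.
  by rewrite (nth_default _ lj).
have tr : transitive (fun x y : R => y <= x) by move=> x y z xy zx; exact: le_trans zx xy.
by apply: (sorted_leq_nth tr _ 0 ss) => //=; rewrite inE ?(leq_ltn_trans ij).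
Qed.

Lemma svals_frob2 m n (M : 'M[R]_(m, n)) :
  frob2 M = \sum_(k < minn m n) nth 0 (svals M) k ^+ 2.
Proof.
have [sz _ _ [U [V [oU oV ME]]]] := svalsP M.
rewrite {1}ME frob2_orthr // frob2_orthl // -/(diag_rect _ _ _) /frob2.
rewrite diag_rect_gram ?sz ?geq_minl // mxtrace_diag.
under eq_bigr do rewrite mxE.
(* The trace runs over all n columns; its terms from [minn m n] on are default values 0. *)
rewrite -[LHS](big_mkord xpredT (fun k => nth 0 (svals M) k ^+ 2)).
rewrite (big_cat_nat (leq0n _) (geq_minr m n)) /= big_mkord.
rewrite [X in _ + X]big_nat_cond [X in _ + X]big1 ?addr0 // => k.
by rewrite andbT => /andP[k1 _]; rewrite nth_default ?sz // expr0n.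
Qed.

(* A common nonzero vector of the span of the leading right singular vectors
   of M' and of the span of the trailing ones of M compares the two values. *)
Lemma svals_sqr_le m n (M M' : 'M[R]_(m, n)) (d : R) k : 0 <= d ->
  (forall v : 'cV[R]_n, frob2 (M' *m v) <= frob2 (M *m v) + d * frob2 v) ->
  nth 0 (svals M') k ^+ 2 <= nth 0 (svals M) k ^+ 2 + d.
Proof.
move=> d0 MM'; have [sz s0 _ [U [V [oU oV ME]]]] := svalsP M.
have [sz' s0' _ [U' [V' [oU' oV' ME']]]] := svalsP M'.
set s := svals M in sz s0 ME *; set s' := svals M' in sz' s0' ME' *.
have [kmn|kmn] := ltnP k (minn m n); last first.
  by rewrite !nth_default ?sz ?sz' // expr0n add0r.
have kn : (k < n)%N by apply: leq_trans kmn (geq_minr _ _).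
(* The columns of [A] are the first k of [V], a zero column at k, and those of [V'] after k. The
   zero column makes [A] singular, and a kernel vector is orthogonal to all the others. *)
pose A : 'M[R]_n := \matrix_(i, j)
  if (j < k)%N then V i j else if (k < j)%N then V' i j else 0.
have [x x0 xA] : exists2 x : 'rV[R]_n, x != 0 & x *m A = 0.
  apply/det0P; apply/eqP; rewrite (expand_det_col _ (Ordinal kn)) big1 // => i _.
  by rewrite mxE /= ltnn mul0r.
pose v := x^T; pose y := V^T *m v; pose y' := V'^T *m v.
have yE (j : 'I_n) : (j < k)%N -> y j 0 = 0.
  move=> jk; move/matrixP: xA => /(_ 0 j); rewrite !mxE => xA0; rewrite -[RHS]xA0.
  by apply: eq_bigr => i _; rewrite !mxE jk mulrC.
have yE' (j : 'I_n) : (k < j)%N -> y' j 0 = 0.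
  move=> kj; move/matrixP: xA => /(_ 0 j); rewrite !mxE => xA0; rewrite -[RHS]xA0.
  by apply: eq_bigr => i _; rewrite !mxE ltnNge (ltnW kj) /= kj mulrC.
have v_gt0 : 0 < frob2 v.
  rewrite lt_def frob2_ge0 andbT frob2T; apply: contra x0 => /eqP /frob2_eq0 ->.
  by rewrite eqxx.
have fE (W : 'M[R]_m) (Z : 'M[R]_n) t : orthogonal_mx W -> size t = minn m n ->
    frob2 (W *m diag_rect m n t *m Z^T *m v) =
      \sum_(j < n) nth 0 t j ^+ 2 * (Z^T *m v) j 0 ^+ 2.
  move=> oW st; rewrite -!mulmxA frob2_orthl // frob2_cVE trmx_mul mulmxA.
  rewrite -[X in X *m _]mulmxA diag_rect_gram ?st ?geq_minl // mul_mx_diag mxE.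
  by apply: eq_bigr => j _; rewrite !mxE; ring.
have nE (Z : 'M[R]_n) : orthogonal_mx Z -> frob2 v = \sum_j (Z^T *m v) j 0 ^+ 2.
  move=> oZ; rewrite -(@frob2_orthl _ _ _ Z^T v) ?frob2E.
    by apply: eq_bigr => j _; rewrite big_ord1.
  by rewrite /orthogonal_mx trmxK; exact: orthogonal_mxC.
(* [M] sees v only through singular values of index at least k, [M'] only through those of index at
   most k. *)
have le_M : frob2 (M *m v) <= nth 0 s k ^+ 2 * frob2 v.
  rewrite ME -/(diag_rect m n s) fE // (nE V) // mulr_sumr; apply: ler_sum => j _.
  have [jk|kj] := ltnP j k; first by rewrite [_ j 0]yE // expr0n !mulr0.
  rewrite ler_wpM2r ?sqr_ge0 // ler_pXn2r ?nnegrE //; exact: svals_nth_le.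
have ge_M' : nth 0 s' k ^+ 2 * frob2 v <= frob2 (M' *m v).
  rewrite ME' -/(diag_rect m n s') fE // (nE V') // mulr_sumr; apply: ler_sum => j _.
  have [kj|jk] := ltnP k j; first by rewrite [_ j 0]yE' // expr0n !mulr0.
  rewrite ler_wpM2r ?sqr_ge0 // ler_pXn2r ?nnegrE //; exact: svals_nth_le.
rewrite -(ler_pM2r v_gt0) mulrDl; apply: le_trans ge_M' _.
by apply: le_trans (MM' v) _; rewrite lerD2r.
Qed.

Lemma svals_le m n (M M' : 'M[R]_(m, n)) k :
  (forall v : 'cV[R]_n, frob2 (M' *m v) <= frob2 (M *m v)) ->
  nth 0 (svals M') k <= nth 0 (svals M) k.
Proof.
move=> MM'; rewrite -(@ler_pXn2r _ 2) ?nnegrE ?svals_ge0 //.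
by rewrite -[leRHS]addr0; apply: svals_sqr_le => // v; rewrite mul0r addr0.
Qed.

(** By monotonicity only the first outer product of the decomposition survives. The hypothesis holds
    by default when the list has a single entry. *)
Lemma svals_rank1 m n (M : 'M[R]_(m.+1, n.+1)) : nth 0 (svals M) 1 = 0 ->
  exists (x : 'I_m.+1 -> R) (y : 'I_n.+1 -> R), forall i j, M i j = x i * y j.
Proof.
move=> s10; have [sz _ _ [U [V [_ _ ME]]]] := svalsP M.
set s := svals M in s10 sz ME.
exists (fun i => nth 0 s 0 * U i 0), (fun j => V j 0) => i j.
rewrite ME mxE (bigD1 0) //= [X in _ + X]big1 ?addr0.
  rewrite !mxE (bigD1 0) //= [X in _ + X]big1 ?addr0; first by rewrite !mxE /= (mulrC (U i 0)).
  by move=> l l0; rewrite !mxE -[_ == _]/(l == 0) (negbTE l0) mulr0.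
move=> l l0; rewrite !mxE big1 ?mul0r // => a _; rewrite !mxE.
case: eqP => [al|_]; last by rewrite mulr0.
suff -> : nth 0 s a = 0 by rewrite mulr0.
have : nth 0 s a <= nth 0 s 1 by apply: svals_nth_le; rewrite al lt0n.
by rewrite s10 => h; apply/le_anti; rewrite h svals_ge0.
Qed.

End SingularValues.

(** * Adjoints and tensor products *)

Section Adjoint.
Variable R : realType.
Local Notation C := (R[i]).

Lemma adjmx_mul m n p (A : 'M[C]_(m, n)) (B : 'M[C]_(n, p)) :
  (A *m B) ^t* = B ^t* *m A ^t*.
Proof. by rewrite trmx_mul map_mxM. Qed.

Lemma adjmx_tens m n p q (A : 'M[C]_(m, n)) (B : 'M[C]_(p, q)) :
  (A *t B) ^t* = A ^t* *t B ^t*.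
Proof. by rewrite trmx_tens map_mxT. Qed.

Lemma adjmxD m n (A B : 'M[C]_(m, n)) : (A + B) ^t* = A ^t* + B ^t*.
Proof. by rewrite linearD /= map_mxD. Qed.

Lemma adjmxZ m n (a : C) (A : 'M[C]_(m, n)) : (a *: A) ^t* = a^* *: A ^t*.
Proof. by rewrite linearZ /= map_mxZ. Qed.

Lemma adjmx_sum m n (I : finType) (A : I -> 'M[C]_(m, n)) :
  (\sum_i A i) ^t* = \sum_i (A i) ^t*.
Proof.
apply: (big_morph (fun X : 'M[C]_(m, n) => X ^t*)) => [A' B'|]; first exact: adjmxD.
by rewrite trmx0 map_mx0.
Qed.

Lemma adjmx1 n : (1%:M : 'M[C]_n) ^t* = 1%:M.
Proof. by rewrite trmx1 map_mx1. Qed.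

Lemma mxtrace_adj n (A : 'M[C]_n) : \tr (A ^t*) = (\tr A)^*.
Proof. by rewrite -map_trmx mxtrace_tr trace_map_mx. Qed.

Lemma mxtrace_sum n (I : finType) (A : I -> 'M[C]_n) :
  \tr (\sum_i A i) = \sum_i \tr (A i).
Proof. exact: raddf_sum. Qed.

Lemma conjC_realc (x : R) : (x%:C)%C^* = (x%:C)%C :> C.
Proof. by apply/CrealP; rewrite complex_real. Qed.

Lemma herm_traceE n (X Y : 'M[C]_n) : hermitian X -> hermitian Y ->
  ((complex.Re (\tr (X *m Y)))%:C)%C = \tr (X *m Y).
Proof.
move=> hX hY; apply: RRe_real; apply/CrealP.
by rewrite -mxtrace_adj adjmx_mul hX hY mxtrace_mulC.
Qed.

Lemma hermitian_sub n (X Y : 'M[C]_n) : hermitian X -> hermitian Y -> hermitian (X - Y).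
Proof.
move=> hX hY; rewrite /hermitian -scaleN1r adjmxD adjmxZ hX hY.
by rewrite rmorphN rmorph1.
Qed.

Lemma hermitian_tens m n (X : 'M[C]_m) (Y : 'M[C]_n) :
  hermitian X -> hermitian Y -> hermitian (X *t Y).
Proof. by move=> hX hY; rewrite /hermitian adjmx_tens hX hY. Qed.

Lemma hermitian_sandwich m n (A : 'M[C]_(m, n)) (X : 'M[C]_m) :
  hermitian X -> hermitian (A ^t* *m X *m A).
Proof. by move=> hX; rewrite /hermitian !adjmx_mul trmxCK hX mulmxA. Qed.

Lemma hermitian_sum n (I : finType) (A : I -> 'M[C]_n) :
  (forall i, hermitian (A i)) -> hermitian (\sum_i A i).
Proof. by move=> hA; rewrite /hermitian adjmx_sum; apply: eq_bigr => i _; exact: hA. Qed.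

Lemma hermitian_scale n (a : R) (X : 'M[C]_n) :
  hermitian X -> hermitian (a%:C%C *: X).
Proof. by move=> hX; rewrite /hermitian adjmxZ hX conjC_realc. Qed.

Lemma mxtrace_tens m n (A : 'M[C]_m) (B : 'M[C]_n) : \tr (A *t B) = \tr A * \tr B.
Proof. by rewrite /mxtrace mulr_sum; apply: eq_bigr => i _; rewrite mxE. Qed.

Lemma tensmx_suml m n p q (I : finType) (a : I -> C) (A : I -> 'M[C]_(m, n))
    (B : 'M[C]_(p, q)) :
  (\sum_i a i *: A i) *t B = \sum_i a i *: (A i *t B).
Proof.
apply/matrixP => k l; rewrite !mxE !summxE mulr_suml; apply: eq_bigr => i _.
by rewrite !mxE mulrA.
Qed.

Lemma tensmx_sumr m n p q (I : finType) (a : I -> C) (A : 'M[C]_(m, n))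
    (B : I -> 'M[C]_(p, q)) :
  A *t (\sum_i a i *: B i) = \sum_i a i *: (A *t B i).
Proof.
apply/matrixP => k l; rewrite !mxE !summxE mulr_sumr; apply: eq_bigr => i _.
by rewrite !mxE mulrCA.
Qed.

Lemma tensmx_delta m n (i i' : 'I_m) (j j' : 'I_n) :
  delta_mx i i' *t delta_mx j j' =
  delta_mx (mxtens_index (i, j)) (mxtens_index (i', j')) :> 'M[C]_(m * n).
Proof.
apply/matrixP => k l; case: (mxtens_indexP k) => a b; case: (mxtens_indexP l) => c d.
rewrite tensmxE !mxE !(inj_eq (can_inj (@mxtens_indexK _ _))) !xpair_eqE -natrM mulnb.
by congr ((_ : bool)%:R); rewrite andbACA.
Qed.

Lemma tensmx11 m n : (1%:M : 'M[C]_m) *t (1%:M : 'M[C]_n) = 1%:M.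
Proof.
apply/matrixP => k l; case: (mxtens_indexP k) => a b; case: (mxtens_indexP l) => c d.
by rewrite tensmxE !mxE !(inj_eq (can_inj (@mxtens_indexK _ _))) !xpair_eqE -natrM mulnb.
Qed.

Lemma hs_norm2E m n (X : 'M[C]_(m, n)) : ((hs_norm2 X)%:C)%C = \tr (X ^t* *m X).
Proof.
rewrite /hs_norm2 rmorph_sum /mxtrace [RHS](eq_bigr (fun j => \sum_i `|X i j| ^+ 2)).
  rewrite exchange_big /=; apply: eq_bigr => i _; rewrite rmorph_sum /=.
  by apply: eq_bigr => j _; rewrite add_Re2_Im2.
by move=> j _; rewrite mxE; apply: eq_bigr => i _; rewrite !mxE normCKC.
Qed.

Lemma hs_norm2_ge0 m n (X : 'M[C]_(m, n)) : 0 <= hs_norm2 X.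
Proof. by do 2!apply: sumr_ge0 => ? _; rewrite addr_ge0 ?sqr_ge0. Qed.

Lemma herm_spectral n (X : 'M[C]_n) : hermitian X ->
  exists (U : 'M[C]_n) (d : 'rV[C]_n), U \is unitarymx /\ X = U *m diag_mx d *m U ^t*.
Proof.
move=> hX; exists ((spectralmx X) ^t*), (spectral_diag X).
rewrite trmxC_unitary spectral_unitarymx trmxCK -invmx_unitary ?spectral_unitarymx //.
by split => //; apply/orthomx_spectralP/normalmxP; rewrite hX.
Qed.

Lemma unitarymxC n (U : 'M[C]_n) : U \is unitarymx -> U ^t* *m U = 1%:M.
Proof. by move=> /unitarymxP /mulmx1C. Qed.

(** The eigenvalues are nonnegative and sum to zero. This handles measurement outcomes of
    probability zero. *)
Lemma psd_trace0 n (X : 'M[C]_n) : hermitian X ->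
  (forall v : 'cV[C]_n, 0 <= ((v ^t*) *m X *m v) 0 0) -> \tr X = 0 -> X = 0.
Proof.
move=> hX pX trX; have [U [d [uU XE]]] := herm_spectral hX.
have UU := unitarymxC uU.
have d_ge0 k : 0 <= d 0 k.
  have := pX (col k U); suff -> : (col k U) ^t* *m X *m col k U = (d 0 k)%:M by rewrite mxE.
  rewrite colE adjmx_mul XE !mulmxA -(mulmxA _ _ U) UU mulmx1.
  rewrite -(mulmxA _ _ U) UU mulmx1 trmx_delta map_delta_mx -rowE row_diag_mx.
  by apply/matrixP => a b; rewrite !ord1 -scalemxAl mul_delta_mx !mxE !eqxx mulr1.
have d0 : d = 0.
  have : \sum_k d 0 k = 0.
    by rewrite -[RHS]trX XE -mulmxA mxtrace_mulC -mulmxA UU mulmx1 mxtrace_diag.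
  move=> /eqP; rewrite psumr_eq0 // => /allP d0; apply/rowP => k; rewrite mxE.
  by apply/eqP; apply: d0; rewrite mem_index_enum.
by rewrite XE d0 linear0 mulmx0 mul0mx.
Qed.

End Adjoint.

(** * Correlation matrices *)

Section HermitianBases.
Variable R : realType.
Local Notation C := (R[i]).

Lemma herm_onb_expand n (F : 'I_(n ^ 2) -> 'M[C]_n) (Y : 'M[C]_n) : herm_onb F ->
  Y = \sum_i \tr (Y *m F i) *: F i.
Proof.
move=> [hF oF sF].
pose E (Z : 'M[C]_n) := \sum_i \tr (Z *m F i) *: F i.
have hermE Z : hermitian Z -> E Z = Z.
  move=> /sF [c ZE]; rewrite /E {2}ZE; apply: eq_bigr => j _; congr (_ *: _).
  rewrite ZE mulmx_suml mxtrace_sum (bigD1 j) //= big1 ?addr0.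
    by rewrite -scalemxAl mxtraceZ [\tr _]oF eqxx mulr1.
  by move=> i ij; rewrite -scalemxAl mxtraceZ [\tr _]oF (negbTE ij) mulr0.
have ED a b Z Z' : E (a *: Z + b *: Z') = a *: E Z + b *: E Z'.
  rewrite /E !scaler_sumr -big_split /=; apply: eq_bigr => i _.
  by rewrite mulmxDl -!scalemxAl mxtraceD !mxtraceZ scalerDl !scalerA.
pose H := 1 *: Y + 1 *: Y ^t*; pose K := 'i *: Y + (- 'i) *: Y ^t*.
have hH : hermitian H by rewrite /hermitian /H !scale1r adjmxD trmxCK addrC.
have hK : hermitian K.
  by rewrite /hermitian /K adjmxD !adjmxZ trmxCK rmorphN /= conjCi opprK addrC.
have YE : Y = 2^-1 *: H + (- ('i / 2)) *: K.
  rewrite /H /K !scale1r !scalerDr !scalerA addrACA -!scalerDl.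
  have -> : 2^-1 + - ('i / 2) * 'i = 1 :> C.
    by rewrite mulNr mulrAC -expr2 sqrCi mulN1r opprK -mulr2n -[_ *+ 2]mulr_natr mulVf ?pnatr_eq0.
  have -> : 2^-1 + - ('i / 2) * - 'i = 0 :> C.
    by rewrite mulrNN mulrAC -expr2 sqrCi mulN1r subrr.
  by rewrite scale1r scale0r addr0.
by rewrite -/(E Y) [in RHS]YE ED !hermE // -YE.
Qed.

(** Both sides are linear in [Y] and agree on product operators, among which are all matrix
    units. *)
Lemma tens_onb_expand m n (F : 'I_(m ^ 2) -> 'M[C]_m) (G : 'I_(n ^ 2) -> 'M[C]_n)
    (Y : 'M[C]_(m * n)) : herm_onb F -> herm_onb G ->
  Y = \sum_i \sum_j \tr (Y *m (F i *t G j)) *: (F i *t G j).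
Proof.
move=> hF hG.
pose E (Z : 'M[C]_(m * n)) := \sum_i \sum_j \tr (Z *m (F i *t G j)) *: (F i *t G j).
have Etens X X' : E (X *t X') = X *t X'.
  rewrite [in RHS](herm_onb_expand X hF) tensmx_suml; apply: eq_bigr => i _.
  rewrite [in RHS](herm_onb_expand X' hG) tensmx_sumr scaler_sumr.
  by apply: eq_bigr => j _; rewrite scalerA tensmx_mul mxtrace_tens.
have Esum (I : finType) (a : I -> C) (Z : I -> 'M[C]_(m * n)) :
    E (\sum_k a k *: Z k) = \sum_k a k *: E (Z k).
  rewrite /E; under [RHS]eq_bigr do rewrite scaler_sumr.
  rewrite [RHS]exchange_big; apply: eq_bigr => i _.
  under [RHS]eq_bigr do rewrite scaler_sumr.
  rewrite [RHS]exchange_big; apply: eq_bigr => j _.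
  rewrite mulmx_suml mxtrace_sum scaler_suml; apply: eq_bigr => k _.
  by rewrite -scalemxAl mxtraceZ scalerA.
rewrite -/(E Y) [Y]matrix_sum_delta pair_big /=.
rewrite (Esum _ (fun p => Y p.1 p.2) (fun p => delta_mx p.1 p.2)).
apply: eq_bigr => -[k l] _ /=; congr (_ *: _).
by case: (mxtens_indexP k) => a b; case: (mxtens_indexP l) => c d; rewrite -tensmx_delta Etens.
Qed.

End HermitianBases.

Section Correlations.
Variables (R : realType) (dA dB : nat).
Local Notation C := (R[i]).
Variables (FA : 'I_(dA ^ 2) -> 'M[C]_dA) (FB : 'I_(dB ^ 2) -> 'M[C]_dB).
Hypotheses (hFA : herm_onb FA) (hFB : herm_onb FB).

Lemma corr_mxE (X : 'M[C]_(dA * dB)) i j : hermitian X ->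
  ((corr_mx FA FB X i j)%:C)%C = \tr (X *m (FA i *t FB j)).
Proof.
move=> hX; rewrite mxE herm_traceE //; apply: hermitian_tens.
  by case: hFA.
by case: hFB.
Qed.

Lemma corr_mxB (X Y : 'M[C]_(dA * dB)) :
  corr_mx FA FB (X - Y) = corr_mx FA FB X - corr_mx FA FB Y.
Proof.
apply/matrixP => i j; rewrite !mxE mulmxBl raddfB /=.
by case: (\tr _) => a b; case: (\tr _).
Qed.

Lemma corr_mx_expand (X : 'M[C]_(dA * dB)) : hermitian X ->
  X = \sum_i \sum_j (corr_mx FA FB X i j)%:C%C *: (FA i *t FB j).
Proof.
move=> hX; rewrite [LHS](tens_onb_expand X hFA hFB).
by apply: eq_bigr => i _; apply: eq_bigr => j _; rewrite corr_mxE.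
Qed.

(** Parseval's identity in the product basis; it turns distances of operators into distances of
    correlation matrices. *)
Lemma hs_norm2_corr (X : 'M[C]_(dA * dB)) : hermitian X ->
  hs_norm2 X = frob2 (corr_mx FA FB X).
Proof.
move=> hX; apply: complexI; rewrite hs_norm2E hX {2}(corr_mx_expand hX) frob2E.
rewrite mulmx_sumr mxtrace_sum rmorph_sum /=; apply: eq_bigr => i _.
rewrite mulmx_sumr mxtrace_sum rmorph_sum /=; apply: eq_bigr => j _.
by rewrite -scalemxAr mxtraceZ -corr_mxE // expr2 rmorphM.
Qed.

Lemma corr_mx_rank1 (X : 'M[C]_(dA * dB)) : (0 < dA)%N -> (0 < dB)%N -> hermitian X ->
  nth 0 (svals (corr_mx FA FB X)) 1 = 0 ->
  exists (Y : 'M[C]_dA) (Z : 'M[C]_dB), hermitian Y /\ X = Y *t Z.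
Proof.
move=> dA0 dB0 hX s1.
have [x [y xy]] : exists (x : 'I_(dA ^ 2) -> R) (y : 'I_(dB ^ 2) -> R),
    forall i j, corr_mx FA FB X i j = x i * y j.
  (* The matrix is generalised so that its dimensions can be rewritten as successors. *)
  move: (corr_mx FA FB X) s1.
  have : (0 < dA ^ 2)%N by rewrite expn_gt0 dA0.
  have : (0 < dB ^ 2)%N by rewrite expn_gt0 dB0.
  case: (dA ^ 2)%N => // m; case: (dB ^ 2)%N => // n _ _; exact: svals_rank1.
exists (\sum_i (x i)%:C%C *: FA i), (\sum_j (y j)%:C%C *: FB j); split.
  by apply: hermitian_sum => i; apply: hermitian_scale; case: hFA.
rewrite [LHS](corr_mx_expand hX) tensmx_suml; apply: eq_bigr => i _.
rewrite tensmx_sumr scaler_sumr; apply: eq_bigr => j _.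
by rewrite xy rmorphM scalerA.
Qed.

End Correlations.

(** * Projective measurements *)

Section Measurements.
Variables (R : realType) (dA dB : nat).
Local Notation C := (R[i]).

(* Locked, lest [mulmxA] see through it. *)
Fact col_proj_key : unit. Proof. by []. Qed.
Definition col_proj n (U : 'M[C]_n) (l : 'I_n) : 'M[C]_n :=
  locked_with col_proj_key (col l U *m (col l U) ^t*).

(** The pinching on A alone; [proj_meas] is its tensor product with the identity map on B. *)
Definition dephase n (U X : 'M[C]_n) : 'M[C]_n :=
  \sum_l col_proj U l *m X *m col_proj U l.

Lemma col_projD n (U : 'M[C]_n) l : col l U *m (col l U) ^t* = col_proj U l.
Proof. by rewrite /col_proj unlock. Qed.

Lemma proj_measE (U : 'M[C]_dA) (rho : 'M[C]_(dA * dB)) : proj_meas U rho =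
  \sum_l (col_proj U l *t (1%:M : 'M[C]_dB)) *m rho *m (col_proj U l *t 1%:M).
Proof. by apply: eq_bigr => l _; rewrite col_projD. Qed.

Lemma col_projE n (U : 'M[C]_n) l : col_proj U l = U *m delta_mx l l *m U ^t*.
Proof.
rewrite -col_projD colE adjmx_mul trmx_delta map_delta_mx !mulmxA.
by rewrite -(mulmxA U) mul_delta_mx.
Qed.

Lemma col_proj_herm n (U : 'M[C]_n) l : hermitian (col_proj U l).
Proof. by rewrite /hermitian -col_projD adjmx_mul trmxCK. Qed.

Lemma col_projM n (U : 'M[C]_n) l k : U \is unitarymx ->
  col_proj U l *m col_proj U k = if l == k then col_proj U l else 0.
Proof.
move=> uU; rewrite !col_projE !mulmxA -(mulmxA _ _ U) unitarymxC // mulmx1.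
rewrite -(mulmxA U) mul_delta_mx_cond.
by case: eqP => [->|_]; rewrite ?mulr1n // mulr0n mulmx0 mul0mx.
Qed.

Lemma col_proj_sum n (U : 'M[C]_n) : U \is unitarymx -> \sum_l col_proj U l = 1%:M.
Proof.
move=> /unitarymxP UU; under eq_bigr do rewrite col_projE.
rewrite -mulmx_suml -mulmx_sumr -[X in U *m X]/(\sum_i _).
suff -> : \sum_i delta_mx i i = 1%:M :> 'M[C]_n by rewrite mulmx1.
by rewrite -diag_const_mx diag_mx_sum_delta; apply: eq_bigr => i _; rewrite mxE scale1r.
Qed.

Lemma dephase_herm n (U X : 'M[C]_n) : hermitian X -> hermitian (dephase U X).
Proof.
move=> hX; apply: hermitian_sum => l; have := hermitian_sandwich (col_proj U l) hX.
by rewrite [X in X *m _ *m _]col_proj_herm.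
Qed.

Lemma dephaseK n (U X : 'M[C]_n) : U \is unitarymx ->
  dephase U (dephase U X) = dephase U X.
Proof.
move=> uU; apply: eq_bigr => l _; rewrite /dephase mulmx_sumr mulmx_suml.
rewrite (bigD1 l) //= big1 ?addr0.
  rewrite !mulmxA col_projM // eqxx.
  by rewrite -(mulmxA _ (col_proj U l) (col_proj U l)) col_projM // eqxx.
by move=> k kl; rewrite !mulmxA col_projM // eq_sym (negbTE kl) !mul0mx.
Qed.

Lemma dephase_sum n (U : 'M[C]_n) (I : finType) (a : I -> C) (X : I -> 'M[C]_n) :
  dephase U (\sum_i a i *: X i) = \sum_i a i *: dephase U (X i).
Proof.
rewrite /dephase; under [RHS]eq_bigr do rewrite scaler_sumr.
rewrite [RHS]exchange_big; apply: eq_bigr => l _.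
rewrite mulmx_sumr mulmx_suml; apply: eq_bigr => i _.
by rewrite -scalemxAr -scalemxAl.
Qed.

Lemma dephase_col_proj n (U : 'M[C]_n) k : U \is unitarymx ->
  dephase U (col_proj U k) = col_proj U k.
Proof.
move=> uU; rewrite /dephase (bigD1 k) //= big1 ?addr0.
  by rewrite !col_projM // eqxx col_projM // eqxx.
by move=> l lk; rewrite col_projM // (negbTE lk) mul0mx.
Qed.

(** Cyclicity of the trace, term by term. Self-adjointness of the pinching is what makes [meas_mx]
    symmetric. *)
Lemma dephase_trace n (U X Y : 'M[C]_n) :
  \tr (dephase U X *m Y) = \tr (X *m dephase U Y).
Proof.
rewrite /dephase mulmx_suml mulmx_sumr !mxtrace_sum; apply: eq_bigr => l _.
by rewrite -!mulmxA mxtrace_mulC !mulmxA.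
Qed.

Lemma herm_dephase_fixed n (X : 'M[C]_n) : hermitian X ->
  exists U : 'M[C]_n, U \is unitarymx /\ dephase U X = X.
Proof.
move=> /herm_spectral [U [d [uU XE]]]; exists U; split => //.
suff -> : X = \sum_l d 0 l *: col_proj U l.
  by rewrite dephase_sum; apply: eq_bigr => l _; rewrite dephase_col_proj.
rewrite XE diag_mx_sum_delta mulmx_sumr mulmx_suml; apply: eq_bigr => l _.
by rewrite -scalemxAr -scalemxAl col_projE.
Qed.

Lemma proj_meas_herm (U : 'M[C]_dA) (rho : 'M[C]_(dA * dB)) :
  hermitian rho -> hermitian (proj_meas U rho).
Proof.
move=> hr; rewrite proj_measE; apply: hermitian_sum => l.
have := hermitian_sandwich (col_proj U l *t (1%:M : 'M[C]_dB)) hr.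
by rewrite adjmx_tens [X in X *t _]col_proj_herm adjmx1.
Qed.

Lemma proj_meas_tens (U : 'M[C]_dA) (X : 'M[C]_dA) (Y : 'M[C]_dB) :
  proj_meas U (X *t Y) = dephase U X *t Y.
Proof.
rewrite proj_measE /dephase.
have -> : \sum_l col_proj U l *m X *m col_proj U l =
          \sum_l 1 *: (col_proj U l *m X *m col_proj U l).
  by apply: eq_bigr => l _; rewrite scale1r.
rewrite tensmx_suml; apply: eq_bigr => l _.
by rewrite scale1r !tensmx_mul mul1mx mulmx1.
Qed.

Lemma proj_meas_sum (U : 'M[C]_dA) (I : finType) (a : I -> C) (X : I -> 'M[C]_(dA * dB)) :
  proj_meas U (\sum_i a i *: X i) = \sum_i a i *: proj_meas U (X i).
Proof.
rewrite proj_measE; under [RHS]eq_bigr do rewrite proj_measE scaler_sumr.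
rewrite [RHS]exchange_big; apply: eq_bigr => l _.
rewrite mulmx_sumr mulmx_suml; apply: eq_bigr => i _.
by rewrite -scalemxAr -scalemxAl.
Qed.

(** Passage to the Heisenberg picture: the measurement moves from the state to the observable of A,
    hence acts on the rows of the correlation matrix. *)
Lemma proj_meas_trace (U : 'M[C]_dA) (rho : 'M[C]_(dA * dB)) (X : 'M[C]_dA)
    (Y : 'M[C]_dB) :
  \tr (proj_meas U rho *m (X *t Y)) = \tr (rho *m (dephase U X *t Y)).
Proof.
rewrite -proj_meas_tens !proj_measE mulmx_suml mulmx_sumr !mxtrace_sum.
by apply: eq_bigr => l _; rewrite -!mulmxA mxtrace_mulC !mulmxA.
Qed.

(* [ket_tens U l] is |l> (x) 1, so that sandwiching by it is the unnormalised
   conditional state of B after outcome l. *)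
Definition ket_tens (U : 'M[C]_dA) (l : 'I_dA) : 'M[C]_(dA * dB, dB) :=
  \matrix_(i, b) (U (mxtens_unindex i).1 l * ((mxtens_unindex i).2 == b)%:R).

Lemma ket_tens_sandwich (U : 'M[C]_dA) l (Y : 'M[C]_dB) :
  ket_tens U l *m Y *m (ket_tens U l) ^t* = col_proj U l *t Y.
Proof.
apply/matrixP => i j; case: (mxtens_indexP i) => a b; case: (mxtens_indexP j) => c d.
rewrite tensmxE -col_projD [in RHS]mxE big_ord1 !mxE (bigD1 d) //= [X in _ + X]big1 ?addr0.
  rewrite !mxE mxtens_indexK /= eqxx mulr1 (bigD1 b) //= [X in _ + X]big1 ?addr0.
    by rewrite !mxE mxtens_indexK /= eqxx mulr1 mulrAC.
  by move=> k kb; rewrite !mxE mxtens_indexK /= eq_sym (negbTE kb) mulr0 mul0r.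
by move=> k kd; rewrite !mxE mxtens_indexK /= eq_sym (negbTE kd) mulr0 rmorph0 mulr0.
Qed.

(** The conditional operator [B l] is positive, and its trace [q l] is the probability of outcome l;
    dividing by it gives the state of B. *)
Lemma proj_meas_cq (U : 'M[C]_dA) (rho : 'M[C]_(dA * dB)) :
  U \is unitarymx -> is_state rho -> cq_state (proj_meas U rho).
Proof.
move=> uU [hr pr tr1]; pose W := ket_tens U; pose B l := (W l) ^t* *m rho *m W l.
have WW l : W l *m (W l) ^t* = col_proj U l *t 1%:M.
  by rewrite -ket_tens_sandwich mulmx1.
have hB l : hermitian (B l) by exact: hermitian_sandwich.
have pB l (v : 'cV[C]_dB) : 0 <= (v ^t* *m B l *m v) 0 0.
  by have := pr (W l *m v); rewrite adjmx_mul !mulmxA.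
have trB_ge0 l : 0 <= \tr (B l).
  apply: sumr_ge0 => b _; have := pB l (delta_mx b 0).
  by rewrite trmx_delta map_delta_mx -rowE -colE !mxE.
pose q l := complex.Re (\tr (B l)).
have qE l : (q l)%:C%C = \tr (B l) by rewrite /q RRe_real // ger0_real.
have q_ge0 l : 0 <= q l by rewrite -ler0c qE.
have q_sum : \sum_l q l = 1.
  apply: complexI; rewrite rmorph_sum rmorph1 -tr1 /=.
  under eq_bigr do rewrite qE /B mxtrace_mulC mulmxA WW.
  rewrite -mxtrace_sum -mulmx_suml.
  suff -> : \sum_l col_proj U l *t (1%:M : 'M[C]_dB) = 1%:M by rewrite mul1mx.
  have -> : \sum_l col_proj U l *t (1%:M : 'M[C]_dB) =
            \sum_l 1 *: (col_proj U l *t (1%:M : 'M[C]_dB)).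
    by apply: eq_bigr => l _; rewrite scale1r.
  rewrite -tensmx_suml; under eq_bigr do rewrite scale1r.
  by rewrite col_proj_sum // tensmx11.
(* [cq_state] asks for a state at every index, so outcomes of probability zero borrow the state of
   [l0]. *)
have [l0 ql0] : exists l0, q l0 != 0.
  apply/existsP; rewrite -negb_forall; apply/negP => /forallP q0.
  have : \sum_l q l == 0 by rewrite big1 // => l _; apply/eqP.
  by rewrite q_sum oner_eq0.
have stB l : q l != 0 -> is_state (((q l)^-1)%:C%C *: B l).
  move=> ql; split.
  - exact: hermitian_scale.
  - by move=> v; rewrite -scalemxAr -scalemxAl mxE mulr_ge0 // ler0c invr_ge0.
  - by rewrite mxtraceZ -qE -rmorphM /= mulVf.
exists U, q, (fun l => if q l != 0 then ((q l)^-1)%:C%C *: B l else ((q l0)^-1)%:C%C *: B l0).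
split => //.
  by move=> l; case: ifP => [|_]; exact: stB.
rewrite proj_measE; apply: eq_bigr => l _.
have -> : col_proj U l *t 1%:M *m rho *m (col_proj U l *t 1%:M) = col_proj U l *t B l.
  by rewrite -!WW -[RHS]ket_tens_sandwich /B !mulmxA.
rewrite col_projD; have [ql|ql] := eqVneq (q l) 0.
  have -> : B l = 0 by apply: psd_trace0 => //; rewrite -qE ql.
  by rewrite ql scale0r tensmx0.
have -> : col_proj U l *t ((q l)^-1%:C%C *: B l) = (q l)^-1%:C%C *: (col_proj U l *t B l).
  by apply/matrixP => i j; rewrite !mxE mulrCA.
by rewrite scalerA -rmorphM /= mulfV // scale1r.
Qed.

Lemma proj_meas_cq_fixed (chi : 'M[C]_(dA * dB)) : cq_state chi ->
  hermitian chi /\ exists U : 'M[C]_dA, U \is unitarymx /\ proj_meas U chi = chi.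
Proof.
move=> [U [q [X [uU _ _ hX ->]]]]; split.
  apply: hermitian_sum => k; apply: hermitian_scale; apply: hermitian_tens.
    by rewrite col_projD; exact: col_proj_herm.
  by case: (hX k).
exists U; split => //; rewrite proj_meas_sum; apply: eq_bigr => k _.
by rewrite col_projD proj_meas_tens dephase_col_proj.
Qed.

End Measurements.

(** * Measurements as real projection matrices *)

Section MeasurementMatrix.
Variables (R : realType) (dA dB : nat).
Local Notation C := (R[i]).
Variables (FA : 'I_(dA ^ 2) -> 'M[C]_dA) (FB : 'I_(dB ^ 2) -> 'M[C]_dB).
Hypotheses (hFA : herm_onb FA) (hFB : herm_onb FB).

(** The matrix of the pinching in the basis [FA]; its entries are real because the pinching
    preserves Hermitian operators. *)
Definition meas_mx (U : 'M[C]_dA) : 'M[R]_(dA ^ 2) :=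
  \matrix_(i, k) complex.Re (\tr (dephase U (FA i) *m FA k)).

Lemma meas_mxE U i k : (meas_mx U i k)%:C%C = \tr (dephase U (FA i) *m FA k).
Proof.
have [hF _ _] := hFA; rewrite mxE herm_traceE //; exact: dephase_herm.
Qed.

Lemma dephase_basis U i :
  dephase U (FA i) = \sum_k (meas_mx U i k)%:C%C *: FA k.
Proof.
rewrite [LHS](herm_onb_expand _ hFA).
by apply: eq_bigr => k _; rewrite meas_mxE.
Qed.

Lemma meas_mx_sym U : (meas_mx U)^T = meas_mx U.
Proof.
apply/matrixP => i k; rewrite mxE; apply: complexI.
by rewrite !meas_mxE dephase_trace mxtrace_mulC.
Qed.

Lemma meas_mx_idem U : U \is unitarymx -> meas_mx U *m meas_mx U = meas_mx U.
Proof.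
move=> uU; apply/matrixP => i k; apply: complexI.
rewrite meas_mxE -dephaseK // dephase_basis dephase_sum mulmx_suml mxtrace_sum.
rewrite mxE rmorph_sum; apply: eq_bigr => l _.
by rewrite rmorphM /= !meas_mxE -scalemxAl mxtraceZ.
Qed.

Lemma corr_proj_meas U (X : 'M[C]_(dA * dB)) : hermitian X ->
  corr_mx FA FB (proj_meas U X) = meas_mx U *m corr_mx FA FB X.
Proof.
move=> hX; apply/matrixP => i j; apply: complexI.
rewrite corr_mxE //; last exact: proj_meas_herm.
rewrite proj_meas_trace dephase_basis tensmx_suml mulmx_sumr mxtrace_sum.
rewrite mxE rmorph_sum; apply: eq_bigr => k _.
by rewrite rmorphM /= corr_mxE // -scalemxAr mxtraceZ.
Qed.

End MeasurementMatrix.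

(** * Singular values under an orthogonal projection *)

Section Contraction.
Variable R : realType.

(** Pythagoras for the complementary projections P and 1 - P. *)
Lemma frob2_projD m n (P : 'M[R]_m) (X : 'M[R]_(m, n)) : P^T = P -> P *m P = P ->
  frob2 X = frob2 (P *m X) + frob2 (X - P *m X).
Proof.
move=> sP iP.
have tX : (X - P *m X)^T = X^T - X^T *m P by rewrite linearB /= trmx_mul sP.
rewrite /frob2 tX trmx_mul sP mulmxBl !mulmxBr !mulmxA -!(mulmxA X^T P P) iP.
by rewrite subrr subr0 !linearB /= addrC subrK.
Qed.

Variables (m n : nat) (P : 'M[R]_m) (X : 'M[R]_(m, n)).
Hypotheses (sP : P^T = P) (iP : P *m P = P).

Lemma svals_proj_le k : nth 0 (svals (P *m X)) k <= nth 0 (svals X) k.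
Proof.
apply: svals_le => v; rewrite -mulmxA (frob2_projD (X *m v) sP iP).
by rewrite lerDl frob2_ge0.
Qed.

(** Pythagoras on each X v, with the residue (X - P X) v bounded through the Frobenius norm. *)
Lemma svals_proj_sqr_ge k : nth 0 (svals X) k ^+ 2 <=
  nth 0 (svals (P *m X)) k ^+ 2 + frob2 (X - P *m X).
Proof.
apply: svals_sqr_le => [|v]; first exact: frob2_ge0.
rewrite (frob2_projD (X *m v) sP iP) -mulmxA lerD2l mulmxA -mulmxBl.
exact: frob2_mulmx_le.
Qed.

Lemma svals_proj_frob2 : frob2 (X - P *m X) =
  \sum_(k < minn m n) (nth 0 (svals X) k ^+ 2 - nth 0 (svals (P *m X)) k ^+ 2).
Proof.
rewrite sumrB -!svals_frob2 [in RHS](frob2_projD X sP iP); ring.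
Qed.

End Contraction.

(** * Elementary symmetric sums of powers *)

Section ElementarySymmetric.
Variables (R : realType) (N : nat).

Definition powesym (h : nat) (p : R) (s : nat -> R) : R :=
  \sum_(S : {set 'I_N} | #|S| == h) \prod_(k in S) s k `^ p.

Lemma powesym_ge0 h p s : 0 <= powesym h p s.
Proof. by apply: sumr_ge0 => S _; apply: prodr_ge0 => k _; exact: powR_ge0. Qed.

Lemma prod_powR_le (p : R) (s s' : nat -> R) (S : {set 'I_N}) : 0 <= p ->
  (forall k, 0 <= s' k) -> (forall k, s' k <= s k) ->
  \prod_(k in S) s' k `^ p <= \prod_(k in S) s k `^ p.
Proof.
move=> p0 s'0 ss'; apply: ler_prod => k _; rewrite powR_ge0 /=.
by rewrite ge0_ler_powR ?nnegrE // (le_trans _ (ss' k)).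
Qed.

Lemma powesym_le h (p : R) (s s' : nat -> R) : 0 <= p ->
  (forall k, 0 <= s' k) -> (forall k, s' k <= s k) -> powesym h p s' <= powesym h p s.
Proof. by move=> *; apply: ler_sum => S _; exact: prod_powR_le. Qed.

(** Monotonicity, with homogeneity of degree h in the p-th powers. *)
Lemma powesym_scale h (p t : R) (s s' : nat -> R) : 0 <= p -> 0 <= t ->
  (forall k, 0 <= s k) -> (forall k, t * s k <= s' k) ->
  (t `^ p) ^+ h * powesym h p s <= powesym h p s'.
Proof.
move=> p0 t0 s0 ts; have ts0 k : 0 <= t * s k by rewrite mulr_ge0.
apply: le_trans (powesym_le h p0 ts0 ts).
rewrite mulr_sumr le_eqVlt; apply/orP; left; apply/eqP; apply: eq_bigr => S /eqP <-.
rewrite -prodr_const -big_split; apply: eq_bigr => k _.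
by rewrite powRM.
Qed.

Lemma pos_lower_bound (I : finType) (x : I -> R) : (forall i, 0 <= x i) ->
  exists2 m : R, 0 < m & forall i, x i != 0 -> m <= x i.
Proof.
(* The initial value 1 keeps the bound positive even if every [x i] vanishes. *)
move=> x0; exists (\big[Order.min/1]_(i | x i != 0) x i).
  by apply/bigmin_gtP; split => // i xi; rewrite lt_def xi x0.
by move=> i xi; exact: bigmin_le_cond.
Qed.

(** Let m bound the nonzero products from below. A total loss under (1 - t^p) m leaves each of them
    at least the fraction t^p of itself; as the other factors only shrink, each single factor keeps
    that fraction too. The last hypothesis on [s] puts every nonzero s_k into some nonzero
    product. *)
Lemma powesym_gap h (p t : R) (s : nat -> R) : 0 < p -> 0 < t < 1 ->
  (forall k, 0 <= s k) ->
  (forall k : 'I_N, s k != 0 -> exists S : {set 'I_N},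
     [/\ k \in S, #|S| = h & forall j, j \in S -> s j != 0]) ->
  exists2 e : R, 0 < e & forall s' : nat -> R, (forall k, 0 <= s' k) ->
    (forall k, s' k <= s k) -> powesym h p s - e < powesym h p s' ->
    forall k : 'I_N, t * s k <= s' k.
Proof.
move=> p0 /andP[t0 t1] s0 sS.
have prod0 (S : {set 'I_N}) : 0 <= \prod_(k in S) s k `^ p.
  by apply: prodr_ge0 => k _; exact: powR_ge0.
have [m m0 mle] := pos_lower_bound prod0.
have tp1 : t `^ p < 1.
  have one : (1 : R) `^ p = 1 by rewrite powR1.
  by rewrite -[ltRHS]one gt0_ltr_powR ?nnegrE ?(ltW t0).
exists ((1 - t `^ p) * m); first by rewrite mulr_gt0 ?subr_gt0.
move=> s' s'0 ss' gap k; have [->|sk] := eqVneq (s k) 0; first by rewrite mulr0.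
have [S [kS cS Spos]] := sS k sk.
pose f (q : nat -> R) (T : {set 'I_N}) := \prod_(j in T) q j `^ p.
have fS0 : f s S != 0.
  by apply/prodf_neq0 => j jS; rewrite powR_eq0 negb_and Spos.
have gapS : f s S - f s' S < (1 - t `^ p) * m.
  have : powesym h p s - powesym h p s' < (1 - t `^ p) * m by rewrite ltrBlDr addrC -ltrBlDr.
  (* No product grows, so the loss on [S] alone is at most the total loss. *)
  apply: le_lt_trans; rewrite /powesym -sumrB (bigD1 S) ?cS //= lerDl.
  by apply: sumr_ge0 => T _; rewrite subr_ge0 prod_powR_le // ltW.
have tS : t `^ p * f s S <= f s' S.
  have := mle S fS0; rewrite -/(f s S) => mS.
  have : (1 - t `^ p) * m <= (1 - t `^ p) * f s S by rewrite ler_pM2l ?subr_gt0.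
  by move=> h1; have := lt_le_trans gapS h1; rewrite mulrBl mul1r; lra.
have split_f q : f q S = q k `^ p * \prod_(j in S | j != k) q j `^ p.
  by rewrite /f (bigD1 k).
have rest_gt0 : 0 < \prod_(j in S | j != k) s j `^ p.
  by apply: prodr_gt0 => j /andP[jS _]; rewrite powR_gt0 // lt_def Spos ?s0.
have : (t * s k) `^ p <= s' k `^ p.
  rewrite -(ler_pM2r rest_gt0) powRM ?(ltW t0) // -mulrA -split_f.
  apply: le_trans tS _; rewrite split_f ler_wpM2l ?powR_ge0 //.
  by apply: ler_prod => j _; rewrite powR_ge0 ge0_ler_powR ?nnegrE ?(ltW p0).
have tsk0 : 0 <= t * s k by rewrite mulr_ge0 // ltW.
move=> hp; rewrite leNgt; apply/negP => lt; move: hp; apply/negP; rewrite -ltNge.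
by rewrite gt0_ltr_powR ?nnegrE.
Qed.

(** With m a positive lower bound of the nonzero squares, d = (1 - t^2) m turns an additive error
    into a relative one. *)
Lemma sqr_gap (t : R) (s : nat -> R) : 0 < t < 1 -> (forall k, 0 <= s k) ->
  exists2 d : R, 0 < d & forall s' : nat -> R, (forall k, 0 <= s' k) ->
    (forall k : 'I_N, s k ^+ 2 <= s' k ^+ 2 + d) -> forall k : 'I_N, t * s k <= s' k.
Proof.
move=> /andP[t0 t1] s0.
have [m m0 mle] := @pos_lower_bound 'I_N (fun k => s k ^+ 2) (fun k => sqr_ge0 _).
have t21 : t ^+ 2 < 1 by rewrite expr_lt1 // ltW.
exists ((1 - t ^+ 2) * m); first by rewrite mulr_gt0 // subr_gt0.
move=> s' s'0 ss' k; have [->|sk] := eqVneq (s k) 0; first by rewrite mulr0.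
have := mle k; rewrite sqrf_eq0 => /(_ sk) mk.
rewrite -(@ler_pXn2r _ 2) ?nnegrE ?mulr_ge0 ?(ltW t0) // exprMn.
have : (1 - t ^+ 2) * m <= (1 - t ^+ 2) * s k ^+ 2 by rewrite ler_pM2l // subr_gt0.
by have := ss' k; lra.
Qed.

End ElementarySymmetric.

(** * Discord *)

(** Stands for letting t tend to 1. If b < a, then t = (a + b) / (2 a) gives the midpoint t a >
    b. *)
Lemma le_of_scaled_le (R : realType) (a b : R) : 0 <= b ->
  (forall t, 0 < t < 1 -> t * a <= b) -> a <= b.
Proof.
move=> b0 ab; rewrite leNgt; apply/negP => ba.
have a0 : 0 < a by apply: le_lt_trans b0 ba.
have q0 : 0 < (a + b) / (a + a) by apply: divr_gt0; lra.
have q1 : (a + b) / (a + a) < 1 by rewrite ltr_pdivrMr; lra.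
have := ab ((a + b) / (a + a)); rewrite q0 q1 => /(_ isT).
suff -> : (a + b) / (a + a) * a = (a + b) / 2 by lra.
by field; rewrite gt_eqF //; lra.
Qed.

Section Discord.
Variables (R : realType) (dA dB : nat).
Local Notation C := (R[i]).
Variables (FA : 'I_(dA ^ 2) -> 'M[C]_dA) (FB : 'I_(dB ^ 2) -> 'M[C]_dB).
Hypotheses (hFA : herm_onb FA) (hFB : herm_onb FB).
Variable rho : 'M[C]_(dA * dB).
Hypothesis hrho : is_state rho.

Local Notation d2 := (minn dA dB ^ 2)%N.

Definition corr_sval (sigma : 'M[C]_(dA * dB)) (k : nat) : R :=
  nth 0 (svals (corr_mx FA FB sigma)) k.

Let s := corr_sval rho.
Let s' (U : 'M[C]_dA) := corr_sval (proj_meas U rho).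

Lemma state_herm : hermitian rho. Proof. by case: hrho. Qed.

Lemma state_dim_gt0 : (0 < dA)%N /\ (0 < dB)%N.
Proof.
apply/andP; rewrite -muln_gt0 lt0n; apply/eqP => d0.
case: hrho => _ _; rewrite /mxtrace big1 => [/eqP|i _]; first by rewrite eq_sym oner_eq0.
by have := ltn_ord i; rewrite [X in (_ < X)%N]d0.
Qed.

Lemma corr_sval_ge0 sigma k : 0 <= corr_sval sigma k.
Proof. exact: svals_ge0. Qed.

Lemma cmn_powE h (p : R) sigma : 1 <= p ->
  cmn FA FB h p sigma `^ p = powesym d2 h p (corr_sval sigma).
Proof.
move=> p1; rewrite /cmn -powRrM mulVf ?gt_eqF ?(lt_le_trans ltr01) //.
by rewrite powRr1 //; exact: powesym_ge0.
Qed.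

Lemma minn_sqr : minn (dA ^ 2) (dB ^ 2) = d2.
Proof.
by case: (leqP dA dB) => [ab|/ltnW ab]; [apply/minn_idPl | apply/minn_idPr]; rewrite leq_exp2r.
Qed.

Lemma meas_sval_le U k : U \is unitarymx -> s' U k <= s k.
Proof.
move=> uU; rewrite /s' /corr_sval (corr_proj_meas hFA hFB _ state_herm).
by apply: svals_proj_le; [exact: meas_mx_sym | exact: meas_mx_idem].
Qed.

Lemma meas_dist U : hs_norm2 (rho - proj_meas U rho) =
  frob2 (corr_mx FA FB rho - meas_mx FA U *m corr_mx FA FB rho).
Proof.
rewrite -(corr_proj_meas hFA hFB _ state_herm) -corr_mxB; apply: hs_norm2_corr => //.
by apply: hermitian_sub; [exact: state_herm | apply: proj_meas_herm; exact: state_herm].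
Qed.

Lemma meas_sval_sqr_ge U k : U \is unitarymx ->
  s k ^+ 2 <= s' U k ^+ 2 + hs_norm2 (rho - proj_meas U rho).
Proof.
move=> uU; rewrite meas_dist /s' /corr_sval (corr_proj_meas hFA hFB _ state_herm).
by apply: svals_proj_sqr_ge; [exact: meas_mx_sym | exact: meas_mx_idem].
Qed.

Lemma meas_dist_svals U : U \is unitarymx ->
  hs_norm2 (rho - proj_meas U rho) = \sum_(k < d2) (s k ^+ 2 - s' U k ^+ 2).
Proof.
move=> uU; rewrite meas_dist svals_proj_frob2 ?minn_sqr; last 2 first.
- exact: meas_mx_sym.
- exact: meas_mx_idem.
by rewrite -(corr_proj_meas hFA hFB _ state_herm).
Qed.

(* Pi_U fixes chi, so rho - Pi_U rho is the residue of rho - chi under the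
   orthogonal projection Pi_U. *)
Lemma meas_dist_le_cq (chi : 'M[C]_(dA * dB)) : cq_state chi ->
  exists2 U, U \is unitarymx & hs_norm2 (rho - proj_meas U rho) <= hs_norm2 (rho - chi).
Proof.
move=> /proj_meas_cq_fixed [hchi [U [uU Uchi]]]; exists U => //.
have hD : hermitian (rho - chi) by apply: hermitian_sub => //; exact: state_herm.
rewrite meas_dist (hs_norm2_corr hFA hFB hD).
set P := meas_mx FA U; set D := corr_mx FA FB (rho - chi).
have -> : corr_mx FA FB rho - P *m corr_mx FA FB rho = D - P *m D.
  rewrite /D corr_mxB mulmxBr -(corr_proj_meas hFA hFB _ hchi) Uchi.
  by rewrite opprB addrA subrK.
have sP : P^T = P by exact: meas_mx_sym.
have iP : P *m P = P by exact: meas_mx_idem.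
by rewrite (frob2_projD D sP iP) lerDr frob2_ge0.
Qed.

Let Mset h p : set R := [set x | exists U : 'M[C]_dA,
  U \is unitarymx /\ x = cmn FA FB h p (proj_meas U rho) `^ p]%classic.

Let Dset : set R := [set x | exists chi : 'M[C]_(dA * dB),
  cq_state chi /\ x = hs_norm2 (rho - chi)]%classic.

Lemma unitary1 : (1%:M : 'M[C]_dA) \is unitarymx.
Proof. by apply/unitarymxP; rewrite adjmx1 mulmx1. Qed.

Lemma Mset_nonempty h p : (Mset h p !=set0)%classic.
Proof. by eexists; exists 1%:M; split; [exact: unitary1 | reflexivity]. Qed.

Lemma Mset_ub h p : 1 <= p -> ubound (Mset h p) (powesym d2 h p s).
Proof.
move=> p1 x [U [uU ->]].
rewrite (cmn_powE h (proj_meas U rho) p1).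
apply: powesym_le.
- exact: (le_trans ler01 p1).
- by move=> k; exact: corr_sval_ge0.
- by move=> k; exact: meas_sval_le.
Qed.

Lemma Dset_has_inf : has_inf Dset.
Proof.
split.
  exists (hs_norm2 (rho - proj_meas 1%:M rho)), (proj_meas 1%:M rho); split => //.
  by apply: proj_meas_cq => //; exact: unitary1.
by exists 0 => x [chi [_ ->]]; exact: hs_norm2_ge0.
Qed.

Lemma discordA_powesym h p : 1 <= p ->
  discordA FA FB h p rho = powesym d2 h p s - sup (Mset h p).
Proof. by move=> p1; rewrite -(cmn_powE h rho p1). Qed.

Lemma discordA_ge0 h p : 1 <= p -> 0 <= discordA FA FB h p rho.
Proof.
move=> p1; rewrite discordA_powesym // subr_ge0.
by apply: ge_sup; [exact: Mset_nonempty | exact: Mset_ub].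
Qed.

Lemma geom_discordA_le U : U \is unitarymx ->
  geom_discordA rho <= hs_norm2 (rho - proj_meas U rho).
Proof.
move=> uU; apply: ge_inf; first by case: Dset_has_inf.
by exists (proj_meas U rho); split => //; exact: proj_meas_cq.
Qed.

Lemma geom_discordA_ge0 : 0 <= geom_discordA rho.
Proof.
by apply: lb_le_inf; [case: Dset_has_inf | move=> x [chi [_ ->]]; exact: hs_norm2_ge0].
Qed.

(** It suffices to reach every fraction T < 1 of the minor sum of rho. A close classical-quantum
    state supplies a measurement that keeps each singular value up to a factor t, hence the sum up
    to t^(p h). *)
Lemma discordA_eq0_of_geom h p : (0 < h)%N -> 1 <= p ->
  geom_discordA rho = 0 -> discordA FA FB h p rho = 0.
Proof.
move=> h0 p1 g0; apply/le_anti; rewrite discordA_ge0 // andbT.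
rewrite discordA_powesym // subr_le0.
have p0 : 0 < p by apply: lt_le_trans p1.
have Mle U : U \is unitarymx -> powesym d2 h p (s' U) <= sup (Mset h p).
  move=> uU; apply: ub_le_sup; first by exists (powesym d2 h p s); exact: Mset_ub.
  by exists U; rewrite (cmn_powE h (proj_meas U rho) p1).
apply: le_of_scaled_le => [|T /andP[T0 T1]].
  by apply: le_trans (Mle _ unitary1); exact: powesym_ge0.
(* Chosen so that t^(p h) = T. *)
pose t := T `^ (p * h%:R)^-1.
have ph0 : 0 < p * h%:R by rewrite mulr_gt0 // ltr0n.
have t01 : 0 < t < 1.
  have one : (1 : R) `^ (p * h%:R)^-1 = 1 by rewrite powR1.
  by rewrite powR_gt0 //= -[ltRHS]one gt0_ltr_powR ?nnegrE ?invr_gt0 ?(ltW T0).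
have tT : (t `^ p) ^+ h = T.
  rewrite -powR_mulrn ?powR_ge0 // -powRrM /t -powRrM mulVf ?gt_eqF //.
  by rewrite powRr1 // ltW.
have [d d0 near] := @sqr_gap R d2 t s t01 (corr_sval_ge0 _).
have [x [chi [cchi ->]] lt_d] := inf_adherent d0 Dset_has_inf.
rewrite -/(geom_discordA rho) g0 add0r in lt_d.
have [U uU Ule] := meas_dist_le_cq cchi.
apply: le_trans (Mle U uU); rewrite -tT; apply: powesym_scale.
- exact: ltW.
- by case/andP: t01 => /ltW.
- exact: corr_sval_ge0.
(* From [d2] on, the singular values of rho are default values 0. *)
move=> k; have [kd|dk] := ltnP k d2.
  apply: (near (s' U) (corr_sval_ge0 _) _ (Ordinal kd)) => j.
  apply: le_trans (meas_sval_sqr_ge j uU) _.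
  by rewrite lerD2l (le_trans Ule) // ltW.
rewrite /s /corr_sval nth_default ?mulr0 ?corr_sval_ge0 //.
by case: (svalsP (corr_mx FA FB rho)) => ->; rewrite minn_sqr.
Qed.

(** Once two singular values are nonzero and h is 1 or 2, every nonzero one lies in a nonzero
    product of h of them, so [powesym_gap] controls them all. *)
Lemma geom_eq0_of_discordA (h : nat) (p : R) : (h == 1)%N || (h == 2)%N -> 1 <= p ->
  discordA FA FB h p rho = 0 -> geom_discordA rho = 0.
Proof.
move=> h12 p1 D0; apply/le_anti; rewrite geom_discordA_ge0 andbT.
have [dA0 dB0] := state_dim_gt0.
(* The product case; it includes [d2] = 1, where [s 1] is a default value. *)
have [s1|s1] := eqVneq (s 1) 0.
  have [X [Y [hX rXY]]] := corr_mx_rank1 hFA hFB dA0 dB0 state_herm s1.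
  have [U [uU UX]] := herm_dephase_fixed hX.
  have := geom_discordA_le uU; rewrite {2 3}rXY proj_meas_tens UX subrr.
  by rewrite /hs_norm2 big1 // => i _; rewrite big1 // => j _; rewrite mxE /= expr0n addr0.
have p0 : 0 < p by apply: lt_le_trans p1.
have d2_gt1 : (1 < d2)%N.
  rewrite ltnNge; apply: contra s1 => d21; apply/eqP; rewrite /s /corr_sval nth_default //.
  by case: (svalsP (corr_mx FA FB rho)) => ->; rewrite minn_sqr.
have s0 : s 0%N != 0.
  have := @svals_nth_le _ _ _ (corr_mx FA FB rho) 0 1 isT.
  rewrite -/(corr_sval rho 0) -/(corr_sval rho 1) -/s => s10.
  by rewrite gt_eqF // (lt_le_trans _ s10) // lt_def s1 corr_sval_ge0.
have sS (k : 'I_d2) : s k != 0 -> exists S : {set 'I_d2},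
    [/\ k \in S, #|S| = h & forall j, j \in S -> s j != 0].
  move=> sk; case/orP: h12 => /eqP ->.
    by exists [set k]; rewrite set11 cards1; split => // j /set1P ->.
  (* The partner of k is index 0, or index 1 when k is 0. *)
  have [j jk sj] : exists2 j : 'I_d2, k != j & s j != 0.
    have [k0|k0] := eqVneq (k : nat) 0%N.
      by exists (Ordinal d2_gt1) => //; rewrite -val_eqE /= k0.
    by exists (Ordinal (ltnW d2_gt1)).
  by exists [set k; j]; rewrite set21 cards2 jk; split => // i /set2P[] ->.
pose K := \sum_(k < d2) s k ^+ 2.
have K0 : 0 <= K by apply: sumr_ge0 => k _; rewrite sqr_ge0.
(* Letting t tend to 1 gives the claim. Formally, a positive g would satisfy T K <= K - g for all T
   = t^2 < 1, hence K <= K - g. *)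
suff bound (t : R) : 0 < t < 1 -> geom_discordA rho <= (1 - t ^+ 2) * K.
  rewrite leNgt; apply/negP => g0; set g := geom_discordA rho in bound g0.
  suff : K <= K - g by lra.
  apply: le_of_scaled_le => [|T /andP[T0 T1]]; last first.
    have := bound (Num.sqrt T); rewrite sqrtr_gt0 T0 /= sqr_sqrtr ?(ltW T0) //.
    rewrite -[X in _ < X]sqrtr1 ltr_sqrt // => /(_ T1); lra.
  (* Any t gives the nonnegativity of K - g that [le_of_scaled_le] asks for; 1/2 is taken. *)
  have : g <= K.
    have half : 0 < (2^-1 : R) < 1 by apply/andP; split; lra.
    apply: le_trans (bound _ half) _; rewrite ler_piMl // gerBl.
    exact: sqr_ge0.
  by rewrite subr_ge0.
move=> t01; have [e e0 gap] := powesym_gap p0 t01 (corr_sval_ge0 rho) sS.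
have supM : has_sup (Mset h p).
  by split; [exact: Mset_nonempty | exists (powesym d2 h p s); exact: Mset_ub].
have [x [U [uU ->]]] := sup_adherent e0 supM.
(* Zero discord makes the supremum equal to the value at rho, so the chosen measurement loses less
   than [e]. *)
have -> : sup (Mset h p) = powesym d2 h p s.
  by apply/eqP; rewrite eq_sym -subr_eq0 -discordA_powesym // D0.
rewrite (cmn_powE h (proj_meas U rho) p1) => lt_e; apply: le_trans (geom_discordA_le uU) _.
rewrite meas_dist_svals // /K mulr_sumr; apply: ler_sum => k _.
have := gap (s' U) (corr_sval_ge0 _) (fun k => meas_sval_le k uU) lt_e k.
case/andP: t01 => t0 _; have tsk : 0 <= t * s k by rewrite mulr_ge0 ?(ltW t0) ?corr_sval_ge0.
move=> tk; have : (t * s k) ^+ 2 <= s' U k ^+ 2.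
  by rewrite ler_pXn2r ?nnegrE ?corr_sval_ge0.
by rewrite exprMn mulrBl mul1r lerD2l lerN2.
Qed.

End Discord.

Theorem theorem5 (R : realType) (dA dB : nat)
  (FA : 'I_(dA ^ 2) -> 'M[R[i]]_dA) (FB : 'I_(dB ^ 2) -> 'M[R[i]]_dB)
  (hFA : herm_onb FA) (hFB : herm_onb FB)
  (rho : 'M[R[i]]_(dA * dB)) (hrho : is_state rho) :
  (forall (h : nat) (p : R), (1 <= h <= minn dA dB ^ 2)%N -> 1 <= p ->
     0 <= discordA FA FB h p rho) /\
  (forall (h : nat) (p : R), (h == 1)%N || (h == 2)%N -> 1 <= p ->
     (discordA FA FB h p rho = 0 <-> geom_discordA rho = 0)).
Proof.
split=> [h p _ p1|h p h12 p1]; first exact: discordA_ge0.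
split; first exact: geom_eq0_of_discordA.
by apply: discordA_eq0_of_geom => //; case/orP: h12 => /eqP ->.
Qed.
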